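(* Consider the MDP $(\mathbb{X},\mathbb{U},\mathcal{T},c)$ and the approximate MDP $(\mathbb{X},\mathbb{U},\hat{\mathcal{T}},\hat c)$ described in the context, and assume the Minorization Condition (with measure $\nu$ such that $\kappa:=1-\nu(\mathbb{X})>0$) and the Lipschitz Condition. Let $D$ be the diameter of $\mathbb{X}$ and let $\delta\in(0,1]$ satisfy $K_{\mathcal{T}}<\left(\frac1\kappa\right)^{\frac{1-\delta}{\delta}}$. Suppose $\hat\pi:\mathbb{X}\to\mathbb{U}$ is a stationary policy that is optimal for the approximate model and satisfies the average cost optimality equation of the approximate model. Then the average cost $J(x_0,\hat\pi)$ of $\hat\pi$ in the original MDP and the optimal average cost $J^*(x_0)$ of the original MDP do not depend on $x_0\in\mathbb{X}$; writing $\rho(\hat\pi)=J(x_0,\hat\pi)$ and $\rho=J^*(x_0)$, $$\rho(\hat\pi)-\rho\le\frac{2}{1-\kappa}\left(\|L_c\|_\infty+\left(\frac{K_cD^{1-\delta}\kappa^{1-\delta}}{1-\kappa\left(\frac{K_{\mathcal{T}}}{\kappa}\right)^{\delta}}\right)\left(\|L_T\|_\infty\right)^{\delta}\right).$$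
   Context: MDP. $(\mathbb{X},d_{\mathbb{X}})$ is a complete separable metric state space, $\mathbb{U}$ a finite action space, $\mathcal{T}(dx_1|x,u)$ a stochastic kernel on $\mathbb{X}$ given $\mathbb{X}\times\mathbb{U}$, $c:\mathbb{X}\times\mathbb{U}\to\mathbb{R}$ a one-stage cost. Admissible policies are (possibly randomized) history-dependent measurable policies; $J(x,\pi)=\limsup_{T\to\infty}\frac1TE^\pi_x\left[\sum_{t=0}^{T-1}c(X_t,U_t)\right]$ and $J^*(x)=\inf_\pi J(x,\pi)$. Approximate model. $\{B_i\}_{i=1}^M$ is a finite partition of $\mathbb{X}$ into Borel bins; $\mu$ is a probability (weight) measure on $\mathbb{X}$ with $\mu(B_i)>0$ for all $i$; $y_i\in B_i$ are representative states, and $\mu_{y_i}(A)=\mu(A)/\mu(B_i)$ for Borel $A\subset B_i$. For $x\in B_i$, $$\hat c(x,u)=\int_{B_i}c(z,u)\mu_{y_i}(dz),\qquad \hat{\mathcal{T}}(A|x,u)=\int_{B_i}\mathcal{T}(A|z,u)\mu_{y_i}(dz).$$ A policy $\hat\pi$ satisfies the average cost optimality equation of the approximate model if there are a constant $\hat\rho$ and a bounded measurable $\hat h$ with, for all $x$, $$\hat\rho+\hat h(x)=\hat c(x,\hat\pi(x))+\int\hat h(x_1)\hat{\mathcal{T}}(dx_1|x,\hat\pi(x))=\min_{u\in\mathbb{U}}\left\{\hat c(x,u)+\int\hat h(x_1)\hat{\mathcal{T}}(dx_1|x,u)\right\}.$$ Loss functions. $L_c(x,u)=|c(x,u)-\hat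 c(x,u)|$ and $L_T(x,u)=W_1(\mathcal{T}(\cdot|x,u),\hat{\mathcal{T}}(\cdot|x,u))$, where $W_1$ is the first-order Wasserstein distance; $\|\cdot\|_\infty$ is the supremum over $(x,u)$. Minorization Condition: there is a positive measure $\nu$ on $\mathbb{X}$ with $\nu(\mathbb{X})>0$ and $\mathcal{T}(B|x,u)\ge\nu(B)$ for all Borel $B$ and all $(x,u)$. Lipschitz Condition: $\mathbb{X}$ is compact, $\mathbb{U}$ is finite, and there are finite constants $K_c,K_{\mathcal{T}}$ such that for all $x,x',u$: $|c(x,u)-c(x',u)|\le K_cd_{\mathbb{X}}(x,x')$ and $W_1(\mathcal{T}(\cdot|x,u),\mathcal{T}(\cdot|x',u))\le K_{\mathcal{T}}d_{\mathbb{X}}(x,x')$. *)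

(* Defs.v *)
From HB Require Import structures.
From mathcomp Require Import all_boot all_order all_algebra.
From mathcomp Require Import all_classical all_reals all_analysis.
From mathcomp Require Import measurable_realfun.
Set Implicit Arguments.
Unset Strict Implicit.
Unset Printing Implicit Defensive.
Import Order.TTheory GRing.Theory Num.Theory.
Import numFieldNormedType.Exports.
Local Open Scope classical_set_scope.
Local Open Scope ring_scope.

HB.mixin Record isPolish (R : realType) (d : measure_display) T
    of Metric R T & Complete T & Measurable d T := {
  borel_measurable : @measurable d T = <<s @open T >> ;
  separable : exists2 D : set T, countable D & dense D }.

#[short(type="polishType")]
HB.structure Definition Polish (R : realType) (d : measure_display) :=
  { T of Metric R T & Complete T & Measurable d T & isPolish R d T }.

HB.mixin Record isDiscreteMeasurable (d : measure_display) T
    of Measurable d T := {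
  discrete_measurableT : forall A : set T, measurable A }.

#[short(type="finDiscreteType")]
HB.structure Definition FinDiscrete (d : measure_display) :=
  { T of Finite T & Measurable d T & isDiscreteMeasurable d T }.

Section metric_quantities.
Context {R : realType}.

Definition diameter (X : metricType R) : R :=
  sup (range (fun p : X * X => mdist p.1 p.2)).

Definition coupling d (X : measurableType d)
    (m1 m2 : {measure set X -> \bar R}) : set (probability (X * X)%type R) :=
  [set g | forall A, measurable A ->
     g (A `*` setT) = m1 A /\ g (setT `*` A) = m2 A].

Definition W1 d (X : polishType R d) (m1 m2 : {measure set X -> \bar R})
    : \bar R :=
  ereal_inf [set (\int[g]_p (mdist p.1 p.2)%:E)%E | g in coupling m1 m2].

End metric_quantities.

Section kernels.
Context {R : realType}.

Section pullback.
Context d0 d1 d2 (T0 : measurableType d0) (T1 : measurableType d1)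
  (T2 : measurableType d2) (k : R.-pker T1 ~> T2) (f : T0 -> T1).

Definition kpullback (mf : measurable_fun setT f) :
  T0 -> {measure set T2 -> \bar R} := fun x => k (f x).

Context (mf : measurable_fun setT f).

Let measurable_kpullback A : measurable A ->
  measurable_fun [set: T0] (kpullback mf ^~ A).
Proof.
move=> mA; exact: (measurableT_comp (measurable_kernel k A mA) mf).
Qed.

HB.instance Definition _ := isKernel.Build _ _ _ _ _ (kpullback mf)
  measurable_kpullback.

Let kpullback_prob x : kpullback mf x setT = 1%E.
Proof. exact: prob_kernel. Qed.

HB.instance Definition _ := Kernel_isProbability.Build _ _ _ _ _
  (kpullback mf) kpullback_prob.

End pullback.

Section product.
Context d0 d1 d2 (T0 : measurableType d0) (T1 : measurableType d1)
  (T2 : measurableType d2) (k1 : R.-pker T0 ~> T1)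
  (k2 : R.-pker (T0 * T1) ~> T2).

Definition pkproduct : T0 -> {measure set (T1 * T2) -> \bar R} :=
  mkproduct k1 k2.

HB.instance Definition _ := isKernel.Build _ _ _ _ _ pkproduct
  (measurable_kproduct k1 k2).

Let pkproduct_prob x : pkproduct x setT = 1%E.
Proof.
rewrite /pkproduct/= /kproduct.
transitivity (\int[k1 x]_y 1)%E; last by rewrite integral_cst// mul1e prob_kernel.
apply: eq_integral => y _; rewrite /kernel.intker_indic indicT/=.
by rewrite integral_cst// mul1e prob_kernel.
Qed.

HB.instance Definition _ := Kernel_isProbability.Build _ _ _ _ _
  pkproduct pkproduct_prob.

End product.

End kernels.

Section mdp.
Context {R : realType} {dX dU : measure_display}
  {X : measurableType dX} {U : measurableType dU}.

Fixpoint hist_display n : measure_display :=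
  if n is m.+1 then
    measure_prod_display (measure_prod_display (hist_display m, dU), dX)
  else dX.

(* hist n holds the trajectories (x_0, u_0, x_1, ..., u_(n-1), x_n),
   nested to the left *)
Fixpoint hist n : measurableType (hist_display n) :=
  match n return measurableType (hist_display n) with
  | 0 => X
  | m.+1 => (hist m * U * X)%type
  end.

Definition last_state n : hist n -> X :=
  match n return hist n -> X with 0 => id | m.+1 => snd end.

Lemma measurable_last_state n : measurable_fun setT (@last_state n).
Proof. by case: n => [|n] /=; [exact: measurable_id|exact: measurable_snd]. Qed.

Definition policy := forall n, R.-pker (hist n) ~> U.

Section stationary.
Context (f : X -> U) (mf : measurable_fun setT f).

Lemma measurable_stationary n : measurable_fun setT (f \o @last_state n).
Proof. exact: (measurableT_comp mf (@measurable_last_state n)). Qed.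

Definition stationary : policy :=
  fun n => kdirac (@measurable_stationary n).

End stationary.

Context (T : R.-pker (X * U) ~> X).

Lemma measurable_next n :
  measurable_fun setT
    (fun p : X * (hist n * U) => (last_state p.2.1, p.2.2)).
Proof.
apply: measurable_fun_pair => /=.
  apply: (measurableT_comp (@measurable_last_state n)).
  exact: (measurableT_comp measurable_fst measurable_snd).
exact: (measurableT_comp measurable_snd measurable_snd).
Qed.

(* law p n x is the law of (X_0, U_0, ..., U_(n-1), X_n) under P^p_x; these
   are the finite-dimensional marginals given by the Ionescu-Tulcea theorem *)
Fixpoint law (p : policy) n : R.-pker X ~> (hist n) :=
  match n return R.-pker X ~> (hist n) with
  | 0 => kdirac (@measurable_id _ X setT)
  | m.+1 =>
      pkproduct
        (pkproduct (law p m) (kpullback (p m) (@measurable_snd _ _ X (hist m))))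
        (kpullback T (@measurable_next m))
  end.

Context (c : X * U -> R).

(* the sum of c(x_t, u_t) over t < n *)
Fixpoint path_cost n : hist n -> R :=
  match n return hist n -> R with
  | 0 => fun _ => 0
  | m.+1 => fun h => path_cost h.1.1 + c (last_state h.1.1, h.1.2)
  end.

Definition avg_cost (p : policy) (x : X) : \bar R :=
  limn_esup (fun n => (n%:R^-1)%:E * \int[law p n x]_h (path_cost h)%:E)%E.

Definition opt_avg_cost (x : X) : \bar R :=
  ereal_inf (range (fun p : policy => avg_cost p x)).

End mdp.
Arguments policy R {dX dU} X U.

Record quantization (R : realType) d (X : measurableType d) := Quantization {
  nbins : nat ;
  bin : 'I_nbins -> set X ;
  measurable_bin : forall i, measurable (bin i) ;
  partition_bin : partition setT bin setT ;
  weight : probability X R ;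
  weight_bin_gt0 : forall i, (0 < weight (bin i))%E ;
  repr_state : 'I_nbins -> X ;
  repr_state_bin : forall i, bin i (repr_state i) }.

Section approximate_model.
Context {R : realType} {dX dU : measure_display}
  {X : measurableType dX} {U : finDiscreteType dU}.
Context (Q : quantization R X).

Lemma bin_of_subproof x : exists i, bin (q := Q) i x.
Proof.
have [+ _ _] := partition_bin Q.
by move=> /seteqP[_ /(_ x Logic.I)][i _ ?]; exists i.
Qed.

Definition bin_of x : 'I_(nbins Q) := sval (cid (bin_of_subproof x)).

Lemma bin_ofP x : bin (bin_of x) x.
Proof. by rewrite /bin_of; case: cid. Qed.

Lemma bin_of_eq i x : bin i x -> bin_of x = i.
Proof.
move=> Bix; have [_ + _] := partition_bin Q; apply => //.
by exists x; split => //; exact: bin_ofP.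
Qed.

(* A |-> weight (A `&` B_i) / weight B_i; the last argument of mnormalize is
   the default for a null B_i, excluded by weight_bin_gt0 *)
Definition bin_weight i : probability X R :=
  mnormalize (mrestr (weight Q) (@measurable_bin _ _ _ Q i)) (weight Q).

Lemma bin_weight_bin i : bin_weight i (bin i) = 1%E.
Proof.
have w0 := weight_bin_gt0 i.
have wfin : weight Q (bin i) \is a fin_num.
  by rewrite fin_num_measure//; exact: measurable_bin.
rewrite /bin_weight/= /mnormalize/= /mrestr setTI.
rewrite gt_eqF//= lt_eqF ?ltey_eq ?wfin//= setIid.
rewrite -[X in (X * _)%E]fineK// -EFinM divff// gt_eqF// fine_gt0// w0.
by rewrite ltey_eq wfin.
Qed.

Lemma measurable_bin_of (F : 'I_(nbins Q) -> U -> \bar R) :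
  measurable_fun [set: X * U] (fun xu => F (bin_of xu.1) xu.2).
Proof.
move=> _ Y mY; rewrite setTI.
rewrite (_ : _ @^-1` _ = \bigcup_(iu in [set iu | Y (F iu.1 iu.2)])
   (bin iu.1 `*` [set iu.2])); last first.
  apply/seteqP; split => [[x u] /= Yxu|[x u] [[i v] /= Yiv [/= Bix ->]]].
    by exists (bin_of x, u) => //; split => //=; exact: bin_ofP.
  by rewrite (bin_of_eq Bix).
apply: fin_bigcup_measurable => [|iu _]; first exact: finite_finset.
apply: measurableX; [exact: measurable_bin|exact: discrete_measurableT].
Qed.

Definition approx_cost (c : X * U -> R) (xu : X * U) : R :=
  \int[bin_weight (bin_of xu.1)]_(z in bin (bin_of xu.1)) c (z, xu.2).

Section approx_kernel.
Context (T : R.-pker (X * U) ~> X).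

Definition approx_kernel_fun (xu : X * U) (A : set X) : \bar R :=
  (\int[bin_weight (bin_of xu.1)]_(z in bin (bin_of xu.1)) T (z, xu.2) A)%E.

Let approx_kernel_fun0 xu : approx_kernel_fun xu set0 = 0%E.
Proof. by apply: integral0_eq => z _; rewrite measure0. Qed.

Let approx_kernel_fun_ge0 xu A : (0 <= approx_kernel_fun xu A)%E.
Proof. by apply: integral_ge0 => z _; exact: measure_ge0. Qed.

Let measurable_slice D u A : measurable A ->
  measurable_fun D (fun z => T (z, u) A).
Proof.
move=> mA; apply: measurable_funTS.
apply: (measurableT_comp (measurable_kernel T A mA)).
exact: measurable_pair2.
Qed.

Let approx_kernel_fun_additive xu : semi_sigma_additive (approx_kernel_fun xu).
Proof.
move=> F mF tF mUF; rewrite /approx_kernel_fun.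
rewrite [X in _ --> X](_ : _ = \big[+%E/0%E]_(0 <= n <oo)
    approx_kernel_fun xu (F n))%E; last first.
  rewrite /approx_kernel_fun -integral_nneseries//.
  - apply: eq_integral => z _; apply: measure_semi_bigcup => //.
  - exact: measurable_bin.
  - by move=> n; exact: measurable_slice.
apply: is_cvg_nneseries => n _ _; exact: approx_kernel_fun_ge0.
Qed.

HB.instance Definition _ xu := isMeasure.Build _ X R (approx_kernel_fun xu)
  (approx_kernel_fun0 xu) (approx_kernel_fun_ge0 xu)
  (@approx_kernel_fun_additive xu).

Definition approx_kernel : X * U -> {measure set X -> \bar R} :=
  approx_kernel_fun.

Let measurable_approx_kernel A : measurable A ->
  measurable_fun [set: X * U] (approx_kernel ^~ A).
Proof.
move=> _; exact: (measurable_bin_of (fun i u =>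
  \int[bin_weight i]_(z in bin i) T (z, u) A)%E).
Qed.

HB.instance Definition _ := isKernel.Build _ _ _ _ R approx_kernel
  measurable_approx_kernel.

Let approx_kernel_prob xu : approx_kernel xu setT = 1%E.
Proof.
rewrite /approx_kernel/= /approx_kernel_fun.
have mB := @measurable_bin _ _ _ Q (bin_of xu.1).
transitivity (\int[bin_weight (bin_of xu.1)]_(z in bin (bin_of xu.1)) 1)%E.
  by apply: eq_integral => z _; rewrite prob_kernel.
by rewrite integral_cst// mul1e; exact: bin_weight_bin.
Qed.

HB.instance Definition _ := Kernel_isProbability.Build _ _ _ _ _
  approx_kernel approx_kernel_prob.

End approx_kernel.
End approximate_model.

Section optimality_and_loss.
Context {R : realType} {dX dU : measure_display}.

Section acoe.
Context {X : measurableType dX} {U : finDiscreteType dU}.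
Context (T : R.-pker (X * U) ~> X) (c : X * U -> R).

Definition acoe_rhs (h : X -> R) (x : X) (u : U) : R :=
  c (x, u) + \int[T (x, u)]_y h y.

(* the seed of the minimum is one of the values ranged over, so the iterated
   minimum is exactly the minimum over U *)
Definition satisfies_acoe (f : X -> U) : Prop :=
  exists (rho : R) (h : X -> R),
    [/\ measurable_fun setT h,
        exists K : R, forall x, `|h x| <= K &
        forall x, rho + h x = acoe_rhs h x (f x) /\
          rho + h x =
            \big[Num.min/acoe_rhs h x (f x)]_(u : U) acoe_rhs h x u].

Definition optimal_policy (p : policy R X U) : Prop :=
  forall x, avg_cost T c p x = opt_avg_cost T c x.

End acoe.

Definition sup_norm (A : Type) (f : A -> \bar R) : \bar R :=
  ereal_sup (range (fun a => `|f a|%E)).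

Definition loss_cost {X : measurableType dX} {U : finDiscreteType dU}
    (Q : quantization R X) (c : X * U -> R) (xu : X * U) : R :=
  `|c xu - approx_cost Q c xu|.

Definition loss_kernel {X : polishType R dX} {U : finDiscreteType dU}
    (Q : quantization R X) (T : R.-pker (X * U) ~> X) (xu : X * U) : \bar R :=
  W1 (T xu) (approx_kernel Q T xu).

End optimality_and_loss.

(* Main.v *)
Require Import Defs.
From HB Require Import structures.
From mathcomp Require Import all_boot all_order all_algebra.
From mathcomp Require Import all_classical all_reals all_analysis.
From mathcomp Require Import measurable_realfun ring lra.
Import Order.TTheory GRing.Theory Num.Theory.
Import numFieldNormedType.Exports.
Local Open Scope classical_set_scope.
Local Open Scope ring_scope.

(** Subtracting the minorizing measure [nu] from every transition law leaves
    kernels of mass [kappa < 1], so the Bellman operator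
    [h |-> min_u (c(x,u) + int h dT(x,u) - int h dnu)] is a [kappa]-contraction
    for the supremum norm ([normalized_step_dist]).  A fixed point [h] of it
    solves the average cost optimality equation with constant [int h dnu]; the
    same operator without the minimum solves the Poisson equation of one
    stationary policy.  Telescoping such an equation along a trajectory shows
    that the corresponding average cost is that constant from every initial
    state, because the bounded terminal term [h(X_n)] disappears after division
    by [n] ([opt_avg_cost_bellman], [stationary_avg_costE]).

    The loss of [pihat] comes from a perturbation argument
    ([bellman_perturbation]).  Let [h'] be the relative value function of the
    approximate model, shifted so as to be a fixed point of the normalized
    operator of that model.  If the two operators differ by at most [e] at [h],
    then [h] and [h'] differ by at most [e / (1 - kappa)].  Since [pihat] is
    greedy for [h'], it misses the minimum in the true optimality equation by at
    most [e + (1 + kappa) e / (1 - kappa) = 2 e / (1 - kappa)] at every state,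
    hence also on average.

    It remains to bound the error [e], that is, to compare the integrals of [h]
    under a true and an approximate transition law.  The Lipschitz constant of
    [h] may be infinite, so one works with its Hoelder constant of exponent
    [delta].  The key inequality ([hoelder_W1_le]) says that for [f] satisfying
    [|f x - f y| <= C d(x,y)^delta] and two probabilities above [nu],
    [|int f dm1 - int f dm2| <= C kappa (W1(m1,m2) / kappa)^delta].  The gain of
    the factor [kappa^(1 - delta)] over Jensen's inequality reflects that only
    the mass [kappa] outside [nu] has to be transported.  Instead of moving that
    mass through Kantorovich duality, [f] is sandwiched between a Lipschitz
    function [g] and [g + r]: the [g] part is controlled by [W1] of the full
    laws, the difference [f - g] only sees the mass [kappa], and optimizing the
    Lipschitz constant gives the power [delta].  With the Lipschitz kernel this
    makes the Bellman operator preserve Hoelder functions of constant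
    [Kc D^(1-delta) / (1 - kappa (KT / kappa)^delta)], so its fixed point [h]
    has this constant; with the loss of the kernel it gives the bound on [e]. *)

Set Implicit Arguments.
Unset Strict Implicit.
Unset Printing Implicit Defensive.

(** * Integrals of bounded measurable functions *)

Definition bounded_measurable {R : realType} {d} {S : measurableType d}
    (f : S -> R) : Prop :=
  measurable_fun setT f /\ exists K, forall x, `|f x| <= K.

Section bounded_measurable_theory.
Context {R : realType} {d} {S : measurableType d}.
Implicit Types (f g : S -> R) (m : {measure set S -> \bar R}).

Lemma bounded_measurable_cst (r : R) : bounded_measurable (fun _ : S => r).
Proof. by split; [exact: measurable_cst|exists `|r|]. Qed.

Lemma bounded_measurableD f g : bounded_measurable f -> bounded_measurable g ->
  bounded_measurable (fun x => f x + g x).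
Proof.
move=> [mf [K fK]] [mg [L gL]]; split; first exact: measurable_funD.
by exists (K + L) => x; rewrite (le_trans (ler_normD _ _))// lerD.
Qed.

Lemma bounded_measurableB f g : bounded_measurable f -> bounded_measurable g ->
  bounded_measurable (fun x => f x - g x).
Proof.
move=> [mf [K fK]] [mg [L gL]]; split; first exact: measurable_funB.
by exists (K + L) => x; rewrite (le_trans (ler_normB _ _))// lerD.
Qed.

Lemma bounded_measurable_comp d' (S' : measurableType d') (g : S' -> S) f :
  measurable_fun setT g -> bounded_measurable f ->
  bounded_measurable (fun x => f (g x)).
Proof.
by move=> mg [mf [K fK]]; split; [exact: measurableT_comp|exists K => x].
Qed.

Lemma bounded_measurable_integrable m f : (m setT < +oo)%E ->
  bounded_measurable f -> m.-integrable setT (EFin \o f).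
Proof.
move=> mfin [mf [K fK]]; apply: measurable_bounded_integrable => //.
exists K; split; first exact: num_real.
by move=> M KM x _ /=; rewrite (le_trans (fK x))// ltW.
Qed.

Lemma Rintegral_cstT m (r : R) : m setT = 1%E -> \int[m]_x r = r.
Proof. by move=> m1; rewrite Rintegral_cst// m1 mulr1. Qed.

Lemma dominated_fin m1 m2 : (m2 setT < +oo)%E ->
  (forall A, measurable A -> (m1 A <= m2 A)%E) -> (m1 setT < +oo)%E.
Proof. by move=> m2fin; move/(_ _ measurableT)/le_lt_trans; apply. Qed.

Lemma ge0_le_measure_Rintegral m1 m2 f : (m2 setT < +oo)%E ->
  (forall A, measurable A -> (m1 A <= m2 A)%E) ->
  bounded_measurable f -> (forall x, 0 <= f x) ->
  \int[m1]_x f x <= \int[m2]_x f x.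
Proof.
move=> m2fin m12 bf f0; have m1fin := dominated_fin m2fin m12.
apply: fine_le.
- exact: integrable_fin_num (bounded_measurable_integrable m1fin bf).
- exact: integrable_fin_num (bounded_measurable_integrable m2fin bf).
- apply: ge0_le_measure_integral => //.
  exact/measurable_EFinP/bf.1.
Qed.

Lemma le_Rintegral_bounded m f g : (m setT < +oo)%E ->
  bounded_measurable f -> bounded_measurable g -> (forall x, f x <= g x) ->
  \int[m]_x f x <= \int[m]_x g x.
Proof.
by move=> mfin bf bg fg; apply: le_Rintegral => //;
  exact: bounded_measurable_integrable.
Qed.

Lemma RintegralD_bounded m f g : (m setT < +oo)%E ->
  bounded_measurable f -> bounded_measurable g ->
  \int[m]_x (f x + g x) = \int[m]_x f x + \int[m]_x g x.
Proof.
by move=> mfin bf bg; apply: RintegralD => //;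
  exact: bounded_measurable_integrable.
Qed.

Lemma RintegralB_bounded m f g : (m setT < +oo)%E ->
  bounded_measurable f -> bounded_measurable g ->
  \int[m]_x (f x - g x) = \int[m]_x f x - \int[m]_x g x.
Proof.
by move=> mfin bf bg; apply: RintegralB => //;
  exact: bounded_measurable_integrable.
Qed.

Lemma norm_Rintegral_le m f K : m setT = 1%E -> bounded_measurable f ->
  (forall x, `|f x| <= K) -> `|\int[m]_x f x| <= K.
Proof.
move=> m1 bf fK; have mfin : (m setT < +oo)%E by rewrite m1 ltry.
rewrite ler_norml; apply/andP; split.
  rewrite -[leLHS](Rintegral_cstT _ m1)//; apply: le_Rintegral_bounded => //.
    exact: bounded_measurable_cst.
  by move=> x; have := fK x; rewrite ler_norml => /andP[].
rewrite -[leRHS](Rintegral_cstT _ m1)//; apply: le_Rintegral_bounded => //.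
  exact: bounded_measurable_cst.
by move=> x; have := fK x; rewrite ler_norml => /andP[].
Qed.

End bounded_measurable_theory.

Lemma prob_kernel_fin {R : realType} {d1 d2} {T1 : measurableType d1}
    {T2 : measurableType d2} (k : R.-pker T1 ~> T2) x : (k x setT < +oo)%E.
Proof. by rewrite prob_kernel ltry. Qed.

Lemma bounded_measurable_kernel {R : realType} {d1 d2} {T1 : measurableType d1}
    {T2 : measurableType d2} (k : R.-pker T1 ~> T2) (F : T1 * T2 -> R) :
  bounded_measurable F -> bounded_measurable (fun x => \int[k x]_y F (x, y)).
Proof.
move=> [mF [K FK]].
have bFx x : bounded_measurable (fun y => F (x, y)).
  by apply: (@bounded_measurable_comp _ _ _ _ _ (fun y => (x, y)));
    [exact: pair1_measurable|split => //; exists K].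
have K0 x : 0 <= F x + K.
  by have := FK x; rewrite ler_norml -lerBlDr sub0r => /andP[].
split; last first.
  by exists K => x; apply: norm_Rintegral_le => //; exact: prob_kernel.
rewrite (_ : (fun _ => _) = (fun x => fine (\int[k x]_y (F (x, y) + K)%:E)%E
    - K)); last first.
  apply/funext => x.
  rewrite -[fine _]/(\int[k x]_y (F (x, y) + K)) RintegralD_bounded//.
  - by rewrite Rintegral_cstT ?prob_kernel// addrK.
  - exact: prob_kernel_fin.
  - exact: bounded_measurable_cst.
apply: measurable_funB; last exact: measurable_cst.
apply: measurableT_comp => //.
apply: (@measurable_kfcomp _ _ T1 T2 R k (fun xy => (F xy + K)%:E)).
  by apply/measurable_EFinP; apply: measurable_funD => //;
    exact: measurable_cst.
by move=> x; rewrite lee_fin.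
Qed.

Section kernel_integrals.
Context {R : realType} {d0 d1 d2} {T0 : measurableType d0}
  {T1 : measurableType d1} {T2 : measurableType d2}.

Lemma Rintegral_kdirac (f : T1 -> T2) (mf : measurable_fun setT f) x
    (F : T2 -> R) : measurable_fun setT F ->
  \int[(kdirac mf : R.-pker T1 ~> T2) x]_y F y = F (f x).
Proof.
move=> mF; rewrite /Rintegral integral_dirac//; last exact/measurable_EFinP.
by rewrite diracT mul1e.
Qed.

(** The product kernel is the composition of [k1] with the kernel
    [(x, y) |-> dirac_y \x k2 (x, y)], and the latter is the image of
    [k2 (x, y)] under [z |-> (y, z)]. *)
Lemma ge0_integral_pkproduct (k1 : R.-pker T0 ~> T1)
    (k2 : R.-pker (T0 * T1) ~> T2) x (F : T1 * T2 -> \bar R) :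
  measurable_fun setT F -> (forall p, 0 <= F p)%E ->
  (\int[pkproduct k1 k2 x]_p F p =
   \int[k1 x]_y \int[k2 (x, y)]_z F (y, z))%E.
Proof.
move=> mF F0.
have mpr : measurable_fun setT (fun p : (T0 * T1) * T1 => (p.1.1, p.2)).
  apply: measurable_fun_pair => /=; last exact: measurable_snd.
  exact: (measurableT_comp measurable_fst measurable_fst).
pose k := pkproduct (kdirac (@measurable_snd _ _ T0 T1) : R.-pker _ ~> _)
  (kpullback k2 mpr).
have kE y A : measurable A ->
    k (x, y) A = pushforward (k2 (x, y)) (fun z => (y, z)) A.
  move=> mA; rewrite /k /pkproduct/= /kproduct integral_dirac//.
    rewrite diracT mul1e /kernel.intker_indic/= integral_indic//.
      by rewrite setIT.
    rewrite -[X in measurable X]setTI.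
    exact: (@pair1_measurable _ _ _ _ y).
  apply: (@measurable_kfcomp _ _ T1 T2 R (kpullback k2
    (@pair1_measurable _ _ T0 T1 x)) (fun yz => (\1_A yz)%:E)).
    by apply/measurable_EFinP; exact: measurable_indic.
  by move=> t; rewrite lee_fin.
transitivity (\int[k1 x]_y \int[k (x, y)]_z F z)%E.
  apply: eq_trans (@integral_kcomp _ _ _ _ _ _ _ k1 k x _ F0 mF).
  apply: eq_measure_integral => A mA _.
  transitivity (\int[k1 x]_y k (x, y) A)%E; last by [].
  apply: eq_integral => y _.
  rewrite kE// /kernel.intker_indic/= integral_indic// ?setIT//.
  rewrite -[X in measurable X]setTI.
  exact: (@pair1_measurable _ _ _ _ y).
apply: eq_integral => y _.
rewrite (eq_measure_integral (pushforward (k2 (x, y)) (fun z => (y, z)))).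
- exact: pair1_measurable.
- by move=> my; rewrite ge0_integral_pushforward.
- by move=> my A mA _; rewrite kE.
Qed.

(** Adding a bound of [F] reduces to the nonnegative case. *)
Lemma Rintegral_pkproduct (k1 : R.-pker T0 ~> T1)
    (k2 : R.-pker (T0 * T1) ~> T2) x (F : T1 * T2 -> R) :
  bounded_measurable F ->
  \int[pkproduct k1 k2 x]_p F p =
  \int[k1 x]_y \int[k2 (x, y)]_z F (y, z).
Proof.
move=> bF; have [mF [K FK]] := bF.
have FK0 p : 0 <= F p + K.
  by have := FK p; rewrite ler_norml -lerBlDr sub0r => /andP[].
have bK d (S : measurableType d) := @bounded_measurable_cst R d S K.
have bFy y : bounded_measurable (fun z => F (y, z)).
  exact: (bounded_measurable_comp (@pair1_measurable _ _ _ _ y)).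
have fin2 (y : T1) := prob_kernel_fin k2 (x, y).
have bI : bounded_measurable (fun y => \int[k2 (x, y)]_z F (y, z)).
  exact: (bounded_measurable_kernel
    (kpullback k2 (@pair1_measurable _ _ T0 T1 x))).
apply: (@addIr _ K).
have -> : \int[pkproduct k1 k2 x]_p F p + K =
    \int[pkproduct k1 k2 x]_p (F p + K).
  rewrite RintegralD_bounded//; first by rewrite Rintegral_cstT// prob_kernel.
  exact: (prob_kernel_fin (pkproduct k1 k2)).
rewrite /Rintegral ge0_integral_pkproduct//; last first.
  by apply/measurable_EFinP; apply: measurable_funD => //;
    exact: measurable_cst.
rewrite (eq_integral (fun y => (\int[k2 (x, y)]_z F (y, z) + K)%:E)).
  rewrite -[fine _]/(\int[k1 x]_y (\int[k2 (x, y)]_z F (y, z) + K)).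
  rewrite RintegralD_bounded//; last exact: prob_kernel_fin.
  by rewrite Rintegral_cstT// prob_kernel.
move=> y _; rewrite -[X in _ = (_ + X)%:E](@Rintegral_cstT _ _ _ (k2 (x, y)))//.
  rewrite -RintegralD_bounded// fineK//.
  apply: integrable_fin_num => //; apply: bounded_measurable_integrable => //.
  exact: bounded_measurableD.
exact: prob_kernel.
Qed.

End kernel_integrals.

(** * Average cost inequalities from one-step inequalities *)

Section limn_esup_bounds.
Context {R : realType}.

(** The error [B], divided by [n], vanishes in the limit, and a limit superior
    ignores the index [0]. *)
Lemma limn_esup_ge_average (u : (\bar R)^nat) (a : R^nat) (r B : R) :
  (forall n, (0 < n)%N -> (u n = (n%:R^-1 * a n)%:E)) ->
  (forall n, n%:R * r - B <= a n) -> (r%:E <= limn_esup u)%E.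
Proof.
move=> ua aB; apply: le_ereal_inf_tmp => _ [A [N _ NA] <-].
apply/lee_addgt0Pr => e e0.
have [k kB] : exists k : nat, `|B| / e < k%:R.
  by exists (Num.truncn (`|B| / e)).+1; exact: truncnS_gt.
pose n := (maxn N k).+1.
have n0 : (0 : R) < n%:R by rewrite ltr0n.
have Bn : B <= n%:R * e.
  rewrite (le_trans (ler_norm B))// -ler_pdivrMr// (le_trans (ltW kB))//.
  by rewrite ler_nat /n leqW// leq_maxr.
apply: (@le_trans _ _ (u n + e%:E)%E).
  rewrite ua// -EFinD lee_fin -lerBlDr mulrC ler_pdivlMr//.
  by rewrite (le_trans _ (aB n))// mulrBl mulrC lerD2l lerN2 mulrC.
apply: leeD => //; apply: ereal_sup_ubound; exists n => //; apply: NA => /=.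
by rewrite /n leqW// leq_maxl.
Qed.

Lemma limn_esup_le_average (u : (\bar R)^nat) (a : R^nat) (r B : R) :
  (forall n, (0 < n)%N -> (u n = (n%:R^-1 * a n)%:E)) ->
  (forall n, a n <= n%:R * r + B) -> (limn_esup u <= r%:E)%E.
Proof.
move=> ua aB; apply/lee_addgt0Pr => e e0.
have [k kB] : exists k : nat, `|B| / e < k%:R.
  by exists (Num.truncn (`|B| / e)).+1; exact: truncnS_gt.
apply: (@le_trans _ _ (ereal_sup (u @` [set n | (k < n)%N]))).
  apply: ereal_inf_lbound; exists [set n | (k < n)%N] => //.
  by exists k.+1.
apply: ge_ereal_sup => _ [n /= kn <-].
have n0 : (0 : R) < n%:R by rewrite ltr0n (leq_trans _ kn).
rewrite ua ?(leq_trans _ kn)// -EFinD lee_fin mulrC ler_pdivrMr//.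
rewrite (le_trans (aB n))// mulrDl mulrC lerD2l mulrC.
rewrite (le_trans (ler_norm B))// -ler_pdivrMr// (le_trans (ltW kB))//.
by rewrite ler_nat ltnW.
Qed.

End limn_esup_bounds.

Section verification.
Context {R : realType} {dX dU : measure_display}
  {X : measurableType dX} {U : measurableType dU}.
Context (T : R.-pker (X * U) ~> X) (c : X * U -> R).
Hypothesis bc : bounded_measurable c.

Definition one_step (g : X -> R) (xu : X * U) : R :=
  c xu + \int[T xu]_y g y.

Lemma bounded_one_step g : bounded_measurable g ->
  bounded_measurable (one_step g).
Proof.
move=> bg; apply: bounded_measurableD => //.
apply: (bounded_measurable_kernel (F := fun p => g p.2) T).
exact: bounded_measurable_comp bg.
Qed.

Lemma measurable_last_action n : measurable_fun setT
  (fun w : hist (X := X) (U := U) n * U => (last_state w.1, w.2)).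
Proof.
apply: measurable_fun_pair => //=.
exact: (measurableT_comp (@measurable_last_state _ _ _ _ n) measurable_fst).
Qed.

Lemma bounded_path_cost n :
  bounded_measurable (fun w : hist (X := X) (U := U) n => path_cost c w).
Proof.
elim: n => [|n IHn] /=; first exact: bounded_measurable_cst.
apply: bounded_measurableD.
  apply: (bounded_measurable_comp (g := fun w => w.1.1)) IHn.
  exact: (measurableT_comp measurable_fst measurable_fst).
apply: (bounded_measurable_comp (g := fun w => (last_state w.1.1, w.1.2))) bc.
exact: (measurableT_comp (@measurable_last_action n) measurable_fst).
Qed.

Variables (p : policy R X U) (g : X -> R).
Hypothesis bg : bounded_measurable g.

Let W n (w : hist (X := X) (U := U) n) := path_cost c w + g (last_state w).

Let bW n : bounded_measurable (@W n).
Proof.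
apply: bounded_measurableD; first exact: bounded_path_cost.
exact: (bounded_measurable_comp (@measurable_last_state _ _ _ _ n)).
Qed.

(** Integrating out the last state and then the last action turns the terminal
    value [g] into the expected one-step value; this is the recursion behind
    both telescoping estimates below. *)
Lemma Rintegral_law_recr n x :
  \int[law T p n.+1 x]_w W w =
  \int[law T p n x]_w
    (path_cost c w + \int[p n w]_u one_step g (last_state w, u)).
Proof.
rewrite Rintegral_pkproduct; last exact: (@bW n.+1).
transitivity (\int[pkproduct (law T p n)
    (kpullback (p n) (@measurable_snd _ _ X (hist n))) x]_w
    (path_cost c w.1 + one_step g (last_state w.1, w.2))).
  apply: eq_Rintegral => w _.
  rewrite /W/= /one_step.
  under eq_Rintegral do rewrite -addrA.
  rewrite !RintegralD_bounded//; try exact: bounded_measurable_cst.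
  - rewrite !Rintegral_cstT; try exact: prob_kernel.
    by [].
  - exact: prob_kernel_fin.
  - exact: prob_kernel_fin.
  - by apply: bounded_measurableD => //; exact: bounded_measurable_cst.
rewrite Rintegral_pkproduct; last first.
  apply: bounded_measurableD.
    exact: bounded_measurable_comp (bounded_path_cost n).
  apply: (bounded_measurable_comp (@measurable_last_action n)).
  exact: bounded_one_step.
apply: eq_Rintegral => w _.
rewrite RintegralD_bounded/=.
- by rewrite Rintegral_cstT//; exact: prob_kernel.
- exact: prob_kernel_fin.
- exact: bounded_measurable_cst.
- apply: (bounded_measurable_comp (g := fun u => (last_state w, u))).
    exact: pair1_measurable.
  exact: bounded_one_step.
Qed.

Let bstep n : bounded_measurable (fun w : hist (X := X) (U := U) n =>
  path_cost c w + \int[p n w]_u one_step g (last_state w, u)).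
Proof.
apply: bounded_measurableD; first exact: bounded_path_cost.
apply: (bounded_measurable_kernel
  (F := fun wu => one_step g (last_state wu.1, wu.2)) (p n)).
by apply: (bounded_measurable_comp (@measurable_last_action n));
  exact: bounded_one_step.
Qed.

Let Rintegral_law0 x : \int[law T p 0 x]_w W w = g x.
Proof.
rewrite (Rintegral_kdirac (@measurable_id _ X setT) x (bW 0).1).
by rewrite /W/= add0r.
Qed.

Let Rintegral_law_addr n x r : \int[law T p n x]_w (W w + r) =
  \int[law T p n x]_w W w + r.
Proof.
rewrite RintegralD_bounded//.
- by rewrite Rintegral_cstT// prob_kernel.
- exact: prob_kernel_fin.
- exact: bounded_measurable_cst.
Qed.

Variable r : R.

Lemma cost_to_go_ge x :
  (forall n (w : hist n), r + g (last_state w) <=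
    \int[p n w]_u one_step g (last_state w, u)) ->
  forall n, n%:R * r + g x <= \int[law T p n x]_w W w.
Proof.
move=> step; elim=> [|n IHn]; first by rewrite mul0r add0r Rintegral_law0.
rewrite Rintegral_law_recr -natr1 mulrDl mul1r addrAC.
rewrite (le_trans (lerD IHn (lexx r)))// -Rintegral_law_addr.
apply: le_Rintegral_bounded => //.
- exact: prob_kernel_fin.
- by apply: bounded_measurableD => //; exact: bounded_measurable_cst.
- by move=> w; rewrite /W -addrA lerD2l addrC.
Qed.

Lemma cost_to_go_le x :
  (forall n (w : hist n), \int[p n w]_u one_step g (last_state w, u) <=
    r + g (last_state w)) ->
  forall n, \int[law T p n x]_w W w <= n%:R * r + g x.
Proof.
move=> step; elim=> [|n IHn]; first by rewrite mul0r add0r Rintegral_law0.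
rewrite Rintegral_law_recr -natr1 mulrDl mul1r addrAC.
rewrite (le_trans _ (lerD IHn (lexx r)))// -Rintegral_law_addr.
apply: le_Rintegral_bounded => //.
- exact: prob_kernel_fin.
- by apply: bounded_measurableD => //; exact: bounded_measurable_cst.
- by move=> w; rewrite /W -addrA lerD2l addrC.
Qed.

Let avg_costE n x : ((n%:R^-1)%:E * \int[law T p n x]_w (path_cost c w)%:E)%E =
  (n%:R^-1 * \int[law T p n x]_w path_cost c w)%:E.
Proof.
rewrite EFinM /Rintegral fineK//; apply: integrable_fin_num => //.
apply: bounded_measurable_integrable; first exact: prob_kernel_fin.
exact: bounded_path_cost.
Qed.

Let terminal_bound : exists K, forall n x,
  `|\int[law T p n x]_w W w - \int[law T p n x]_w path_cost c w| <= K.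
Proof.
have [_ [K gK]] := bg; exists K => n x.
rewrite -RintegralB_bounded//; first last.
- exact: bounded_path_cost.
- exact: prob_kernel_fin.
apply: norm_Rintegral_le; first exact: prob_kernel.
  by apply: bounded_measurableB => //; exact: bounded_path_cost.
by move=> w; rewrite /W addrAC subrr add0r.
Qed.

Lemma avg_cost_ge x :
  (forall n (w : hist n), r + g (last_state w) <=
    \int[p n w]_u one_step g (last_state w, u)) ->
  (r%:E <= avg_cost T c p x)%E.
Proof.
move=> /(cost_to_go_ge x) step; have [K WK] := terminal_bound.
apply: (limn_esup_ge_average (B := K - g x)) => [n _|n]; first exact: avg_costE.
have := WK n x; rewrite ler_norml => /andP[_]; have := step n; lra.
Qed.

Lemma avg_cost_le x :
  (forall n (w : hist n), \int[p n w]_u one_step g (last_state w, u) <=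
    r + g (last_state w)) ->
  (avg_cost T c p x <= r%:E)%E.
Proof.
move=> /(cost_to_go_le x) step; have [K WK] := terminal_bound.
apply: (limn_esup_le_average (B := K + g x)) => [n _|n]; first exact: avg_costE.
have := WK n x; rewrite ler_norml => /andP[+ _]; have := step n; lra.
Qed.

End verification.

Section stationary_verification.
Context {R : realType} {dX dU : measure_display}
  {X : measurableType dX} {U : measurableType dU}.
Context (T : R.-pker (X * U) ~> X) (c : X * U -> R).
Hypothesis bc : bounded_measurable c.
Context (g : X -> R) (bg : bounded_measurable g) (r : R).
Context (f : X -> U) (mf : measurable_fun setT f).

Let Rintegral_stationary n (w : hist n) :
  \int[stationary (R := R) mf n w]_u one_step T c g (last_state w, u) =
  one_step T c g (last_state w, f (last_state w)).
Proof.
rewrite (Rintegral_kdirac (@measurable_stationary _ _ _ _ _ mf n))//.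
apply: measurableT_comp; last exact: pair1_measurable.
exact: (bounded_one_step T bc bg).1.
Qed.

Lemma stationary_avg_cost_le x :
  (forall y, one_step T c g (y, f y) <= r + g y) ->
  (avg_cost T c (stationary mf) x <= r%:E)%E.
Proof.
move=> step; apply: (avg_cost_le bc bg) => n w.
by rewrite Rintegral_stationary.
Qed.

Lemma stationary_avg_cost_ge x :
  (forall y, r + g y <= one_step T c g (y, f y)) ->
  (r%:E <= avg_cost T c (stationary mf) x)%E.
Proof.
move=> step; apply: (avg_cost_ge bc bg) => n w.
by rewrite Rintegral_stationary.
Qed.

(** A randomized action averages the one-step values over actions, so it
    cannot beat a lower bound valid for every action. *)
Lemma opt_avg_cost_ge x : (forall y u, r + g y <= one_step T c g (y, u)) ->
  (r%:E <= opt_avg_cost T c x)%E.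
Proof.
move=> step; apply: le_ereal_inf_tmp => _ [p _ <-].
apply: (avg_cost_ge bc bg) => n w.
rewrite -[leLHS](Rintegral_cstT (m := p n w)); last exact: prob_kernel.
apply: le_Rintegral_bounded => //.
- exact: prob_kernel_fin.
- exact: bounded_measurable_cst.
- apply: (bounded_measurable_comp (g := fun u => (last_state w, u))).
    exact: pair1_measurable.
  exact: bounded_one_step.
Qed.

End stationary_verification.

(** * Contractions and minorized measures *)

Section contraction.
Context {R : realType} {S : Type}.

Definition pointwise_closed (P : (S -> R) -> Prop) : Prop :=
  forall (s : nat -> S -> R) h, (forall n, P (s n)) ->
    (forall x, s n x @[n --> \oo] --> h x) -> P h.

(** The sequences [s n x - k^n b / (1 - k)] and [s n x + k^n b / (1 - k)] are
    respectively nondecreasing and nonincreasing, so the supremum of the first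
    lies between them. *)
Lemma geometric_step_limit (s : nat -> S -> R) (k b : R) :
  0 <= k -> k < 1 -> (forall n x, `|s n.+1 x - s n x| <= k ^+ n * b) ->
  exists h, forall n x, `|s n x - h x| <= k ^+ n * (b / (1 - k)).
Proof.
move=> k0 k1 sb; have k1' : 0 < 1 - k by rewrite subr_gt0.
pose B := b / (1 - k).
have bB : b = B - k * B by rewrite /B; field; rewrite gt_eqF.
have {}sb n x : `|s n.+1 x - s n x| <= k ^+ n * B - k ^+ n.+1 * B.
  by rewrite exprSr -mulrA -mulrBr -bB.
pose lo x n := s n x - k ^+ n * B; pose up x n := s n x + k ^+ n * B.
have lo_nd x : nondecreasing_seq (lo x).
  apply/nondecreasing_seqP => n; rewrite /lo; have := sb n x.
  by rewrite ler_norml => /andP[? _]; lra.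
have up_ni x : nonincreasing_seq (up x).
  apply/nonincreasing_seqP => n; rewrite /up; have := sb n x.
  by rewrite ler_norml => /andP[_ ?]; lra.
have B0 (x : S) : 0 <= B.
  have := le_trans (normr_ge0 _) (sb 0%N x).
  by rewrite expr0 expr1 -mulrBl pmulr_rge0.
have lo_up x m n : lo x m <= up x n.
  rewrite (le_trans (lo_nd x _ _ (leq_maxl m n)))//.
  rewrite (le_trans _ (up_ni x _ _ (leq_maxr m n)))// /lo /up.
  by rewrite lerD2l ge0_cp// mulr_ge0 ?exprn_ge0// (B0 x).
exists (fun x => sup (range (lo x))) => n x; rewrite ler_distlC.
apply/andP; split.
  apply: ub_le_sup; last by exists n.
  by exists (up x 0%N) => _ [m _ <-]; exact: lo_up.
apply: ge_sup; first by exists (lo x n), n.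
by move=> _ [m _ <-]; exact: lo_up.
Qed.

(** Banach's theorem for functions with the uniform distance.  The class [P]
    takes the place of a complete function space: closure under pointwise
    limits is easy to check for measurability, bounds and moduli of
    continuity, and the limit inherits all of them at once. *)
Lemma contraction_fixpoint (P : (S -> R) -> Prop) (F : (S -> R) -> S -> R)
    (k b : R) (h0 : S -> R) :
  0 <= k -> k < 1 -> pointwise_closed P ->
  (forall h, P h -> P (F h)) ->
  (forall h1 h2 e, P h1 -> P h2 -> (forall x, `|h1 x - h2 x| <= e) ->
    forall x, `|F h1 x - F h2 x| <= k * e) ->
  P h0 -> (forall x, `|F h0 x - h0 x| <= b) ->
  exists2 h, P h & forall x, F h x = h x.
Proof.
move=> k0 k1 Pcl PF Fk Ph0 Fb; pose s n := iter n F h0.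
have Ps n : P (s n) by elim: n => // n IHn; exact: PF.
have sb n x : `|s n.+1 x - s n x| <= k ^+ n * b.
  elim: n x => [|n IHn] x; first by rewrite expr0 mul1r; exact: Fb.
  by rewrite exprS -mulrA; exact: (Fk _ _ _ (Ps n.+1) (Ps n) IHn).
have [h sh] := geometric_step_limit k0 k1 sb.
set B := b / (1 - k) in sh.
have kB0 : k ^+ n * B @[n --> \oo] --> (0 : R).
  rewrite -[X in _ --> X](mul0r B); apply: cvgMl.
  by apply: cvg_expr; rewrite ger0_norm.
have sh_cvg x : s n x @[n --> \oo] --> h x.
  apply/cvgrPdist_le => e e0.
  have /cvgrPdist_le/(_ e e0) := kB0; apply: filterS => n.
  rewrite sub0r normrN distrC => /(le_trans (ler_norm _)).
  exact: le_trans.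
have Ph : P h by exact: Pcl sh_cvg.
exists h => // x; apply/eqP; rewrite -subr_eq0 -normr_le0.
have bnd n : `|F h x - h x| <= k ^+ n * B + k ^+ n * B.
  rewrite -[F h x - h x](subrKA (s n.+1 x)) (le_trans (ler_normD _ _))// lerD//.
    rewrite distrC (le_trans (Fk _ _ _ (Ps n) Ph (sh n) x))//.
    by rewrite ler_piMl ?(ltW k1)// (le_trans _ (sh n x)).
  rewrite (le_trans (sh n.+1 x))// exprS -mulrA.
  by rewrite ler_piMl ?(ltW k1)// (le_trans _ (sh n x)).
have kB2 : k ^+ n * B + k ^+ n * B @[n --> \oo] --> (0 : R).
  by rewrite -[X in _ --> X]addr0; exact: cvgD.
by apply: (cvgr_to_ge kB2); exact: nearW.
Qed.

End contraction.

Lemma pointwise_closed_measurable {R : realType} {d} {S : measurableType d} :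
  pointwise_closed (fun h : S -> R => measurable_fun setT h).
Proof. by move=> s h ms sh; apply: (measurable_fun_cvg ms) => x _. Qed.

Lemma pointwise_closed_norm_le {R : realType} {S : Type} (K : R) :
  pointwise_closed (fun h : S -> R => forall x, `|h x| <= K).
Proof.
move=> s h sK sh x; apply: (cvgr_to_le (cvg_norm (sh x))).
by apply: nearW => n; exact: sK.
Qed.

Lemma pointwise_closed_modulus {R : realType} {S : Type} (w : S -> S -> R) :
  pointwise_closed (fun h : S -> R => forall x y, `|h x - h y| <= w x y).
Proof.
move=> s h sw sh x y; apply: (cvgr_to_le (cvg_norm (cvgB (sh x) (sh y)))).
by apply: nearW => n; exact: sw.
Qed.

Lemma pointwise_closedI {R : realType} {S : Type} (P Q : (S -> R) -> Prop) :
  pointwise_closed P -> pointwise_closed Q ->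
  pointwise_closed (fun h => P h /\ Q h).
Proof.
move=> Pcl Qcl s h sPQ sh; split.
- by apply: Pcl sh => n; have [] := sPQ n.
- by apply: Qcl sh => n; have [] := sPQ n.
Qed.

Section minorized_integrals.
Context {R : realType} {d} {S : measurableType d}.
Implicit Types (m nu : {measure set S -> \bar R}) (h : S -> R).

(** [m - nu] is a positive measure of mass [1 - nu setT]: integrate the
    nonnegative function [e - h] against both measures. *)
Lemma minorized_Rintegral_le m nu h e : m setT = 1%E ->
  (forall A, measurable A -> (nu A <= m A)%E) -> bounded_measurable h ->
  (forall x, h x <= e) ->
  \int[m]_x h x - \int[nu]_x h x <= (1 - fine (nu setT)) * e.
Proof.
move=> m1 num bh he.
have mfin : (m setT < +oo)%E by rewrite m1 ltry.
have nufin := dominated_fin mfin num.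
have be := @bounded_measurable_cst R _ S e.
have eh0 x : 0 <= e - h x by rewrite subr_ge0.
have := ge0_le_measure_Rintegral mfin num (bounded_measurableB be bh) eh0.
by rewrite !RintegralB_bounded// (Rintegral_cstT _ m1) Rintegral_cst//; lra.
Qed.

Lemma minorized_norm_le m nu h e : m setT = 1%E ->
  (forall A, measurable A -> (nu A <= m A)%E) -> bounded_measurable h ->
  (forall x, `|h x| <= e) ->
  `|\int[m]_x h x - \int[nu]_x h x| <= (1 - fine (nu setT)) * e.
Proof.
move=> m1 num bh he.
have mfin : (m setT < +oo)%E by rewrite m1 ltry.
have nufin := dominated_fin mfin num.
have b0 := @bounded_measurable_cst R _ S 0.
have intN (mu : {measure set S -> \bar R}) : (mu setT < +oo)%E ->
    \int[mu]_x (0 - h x) = - \int[mu]_x h x.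
  by move=> mufin; rewrite RintegralB_bounded// Rintegral_cst// mul0r sub0r.
rewrite ler_norml; apply/andP; split.
  have Nhe x : 0 - h x <= e.
    by have := he x; rewrite sub0r; apply: le_trans; rewrite -normrN ler_norm.
  have := minorized_Rintegral_le m1 num (bounded_measurableB b0 bh) Nhe.
  by rewrite !intN//; lra.
by apply: minorized_Rintegral_le => // x; exact: le_trans (ler_norm _) (he x).
Qed.

End minorized_integrals.

(** * Fixed points of the normalized Bellman operator *)

Section minimum_over_actions.
Context {R : realType} {dX dU : measure_display}
  {X : measurableType dX} {U : finDiscreteType dU}.

Lemma measurable_sections (F : X * U -> R) :
  (forall u, measurable_fun setT (fun x => F (x, u))) -> measurable_fun setT F.
Proof.
move=> mF _ Y mY; rewrite setTI.
rewrite (_ : F @^-1` Y = \bigcup_(u in [set: U])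
    ((fun x => F (x, u)) @^-1` Y `*` [set u])); last first.
  apply/seteqP; split => [[x u] /= Yxu|[x u] [v _ [/= Yv ->]]] //.
  by exists u.
apply: fin_bigcup_measurable => [|u _]; first exact: finite_finset.
apply: measurableX; last exact: discrete_measurableT.
by rewrite -[X in measurable X]setTI; exact: mF.
Qed.

(** Comparing the actions one after the other keeps the best action so far
    measurable, the action space being finite. *)
Lemma measurable_minimizer (F : X * U -> R) (u0 : U) : measurable_fun setT F ->
  exists2 f : X -> U, measurable_fun setT f &
    forall x u, F (x, f x) <= F (x, u).
Proof.
move=> mF.
suff [f mf fmin] : exists2 f : X -> U, measurable_fun setT f &
    forall x u, u \in enum U -> F (x, f x) <= F (x, u).
  by exists f => // x u; apply: fmin; rewrite mem_enum.
elim: (enum U) => [|v s [f mf fmin]].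
  by exists (fun=> u0) => //; exact: measurable_cst.
have mFg (g : X -> U) : measurable_fun setT g ->
    measurable_fun setT (fun x => F (x, g x)).
  move=> mg; apply: (measurableT_comp mF).
  by apply: measurable_fun_pair => //; exact: measurable_id.
exists (fun x => if F (x, v) <= F (x, f x) then v else f x).
  apply: measurable_fun_ifT => //.
  by apply: measurable_fun_ler; apply: mFg => //; exact: measurable_cst.
move=> x u; rewrite inE; case: ifPn => [vf|].
  by move=> /predU1P[->//|/(fmin x)]; exact: le_trans.
by rewrite -ltNge => /ltW fv /predU1P[->//|/(fmin x)].
Qed.

(** The minimum over the actions; [u0] only witnesses that there is an action,
    and the value does not depend on it. *)
Definition min_action (u0 : U) (F : U -> R) : R := F [arg min_(u < u0) F u]%O.

Lemma min_action_le u0 F u : min_action u0 F <= F u.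
Proof. by rewrite /min_action; case: arg_minP => // v _; exact. Qed.

Lemma min_action_unique u0 (F : U -> R) v :
  (forall u, F v <= F u) -> min_action u0 F = F v.
Proof.
by move=> Fv; apply/eqP; rewrite eq_le min_action_le/= /min_action Fv.
Qed.

Lemma min_action_dist u0 (F G : U -> R) e : (forall u, `|F u - G u| <= e) ->
  `|min_action u0 F - min_action u0 G| <= e.
Proof.
move=> FG; rewrite ler_norml.
have := FG [arg min_(u < u0) F u]%O; have := FG [arg min_(u < u0) G u]%O.
have := min_action_le u0 F [arg min_(u < u0) G u]%O.
have := min_action_le u0 G [arg min_(u < u0) F u]%O.
rewrite -/(min_action u0 F) -/(min_action u0 G).
by rewrite !ler_norml => ? ? /andP[? ?] /andP[? ?]; apply/andP; split; lra.
Qed.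

Lemma measurable_min_action u0 (F : X * U -> R) : measurable_fun setT F ->
  measurable_fun setT (fun x => min_action u0 (fun u => F (x, u))).
Proof.
move=> mF; have [f mf fmin] := measurable_minimizer u0 mF.
rewrite (_ : (fun _ => _) = (fun x => F (x, f x))); last first.
  by apply/funext => x; exact: (@min_action_unique u0 (fun u => F (x, u))).
apply: (measurableT_comp mF).
by apply: measurable_fun_pair => //; exact: measurable_id.
Qed.

End minimum_over_actions.

Section normalized_operator.
Context {R : realType} {dX dU : measure_display}
  {X : measurableType dX} {U : finDiscreteType dU}.
Context (T : R.-pker (X * U) ~> X) (c : X * U -> R).
Context (nu : {measure set X -> \bar R}).
Hypothesis bc : bounded_measurable c.
Hypothesis nuT : forall A xu, measurable A -> (nu A <= T xu A)%E.

Let kappa := 1 - fine (nu setT).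
Hypotheses (kappa_ge0 : 0 <= kappa) (kappa_lt1 : kappa < 1).

(** The one-step value for the subprobability kernel [T - nu]. *)
Definition normalized_step (h : X -> R) (xu : X * U) : R :=
  one_step T c h xu - \int[nu]_y h y.

Lemma normalized_step_dist h1 h2 e xu :
  bounded_measurable h1 -> bounded_measurable h2 ->
  (forall x, `|h1 x - h2 x| <= e) ->
  `|normalized_step h1 xu - normalized_step h2 xu| <= kappa * e.
Proof.
move=> b1 b2 h12; have T1 : T xu setT = 1%E := prob_kernel xu.
have Tfin : (T xu setT < +oo)%E by rewrite T1 ltry.
have nufin := dominated_fin Tfin (fun A mA => nuT xu mA).
have := minorized_norm_le T1 (fun A mA => nuT xu mA)
  (bounded_measurableB b1 b2) h12.
rewrite !RintegralB_bounded//; congr (`|_| <= _).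
by rewrite /normalized_step /one_step; ring.
Qed.

Lemma bounded_normalized_step h : bounded_measurable h ->
  bounded_measurable (normalized_step h).
Proof.
move=> bh; apply: bounded_measurableB; last exact: bounded_measurable_cst.
exact: bounded_one_step.
Qed.

(** [G] abstracts what is done with the action: minimizing over it or taking the
    one prescribed by a policy.  Bounded functions are handled by the ball of
    radius [K] with [M + kappa K = K], where [M] bounds the cost: the operator
    maps this ball to itself. *)
Lemma normalized_fixpoint (P : (X -> R) -> Prop)
    (G : (X * U -> R) -> (X -> R)) :
  pointwise_closed P -> P (fun=> 0) ->
  (forall a, bounded_measurable a -> measurable_fun setT (G a)) ->
  (forall a b x e, (forall u, `|a (x, u) - b (x, u)| <= e) ->
    `|G a x - G b x| <= e) ->
  (G (fun=> 0) = fun=> 0) ->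
  (forall h, bounded_measurable h -> P h -> P (G (normalized_step h))) ->
  exists h, [/\ bounded_measurable h, P h &
    forall x, h x = G (normalized_step h) x].
Proof.
move=> Pcl P0 mG Gdist G0 PG; have [_ [M cM]] := bc.
have Gnorm a x e : (forall u, `|a (x, u)| <= e) -> `|G a x| <= e.
  move=> ae; have := Gdist a (fun=> 0) x e; rewrite G0 subr0; apply => u.
  by rewrite subr0.
have [xu0|noX] := pselect (inhabited (X * U)%type); last first.
  exists (fun=> 0); split => // [|x]; first exact: bounded_measurable_cst.
  apply/eqP; rewrite eq_sym -normr_le0; apply: Gnorm => u.
  by case: noX; split; exact: (x, u).
have M0 : 0 <= M by case: xu0 => xu; exact: le_trans (cM xu).
have kappa1 : 0 < 1 - kappa by rewrite subr_gt0.
pose K := M / (1 - kappa).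
have KE : M + kappa * K = K by rewrite /K; field; rewrite gt_eqF.
have K0 : 0 <= K by rewrite divr_ge0// ltW.
pose Q (h : X -> R) :=
  (measurable_fun [set: X] h /\ (forall x, `|h x| <= K)) /\ P h.
have bQ h : Q h -> bounded_measurable h.
  by move=> [[mh hK] _]; split => //; exists K.
have b0 := @bounded_measurable_cst R _ X 0.
have Q0 : Q (fun=> 0).
  by split => //; split => [|x]; [exact: b0.1|rewrite normr0].
have step0 xu : normalized_step (fun=> 0) xu = c xu.
  rewrite /normalized_step /one_step !Rintegral_cst//.
  by rewrite !mul0r addr0 subr0.
have Qcl : pointwise_closed Q.
  apply: pointwise_closedI => //; apply: pointwise_closedI.
    exact: pointwise_closed_measurable.
  exact: pointwise_closed_norm_le.
have stepK h : Q h -> forall x, `|G (normalized_step h) x| <= K.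
  move=> Qh x; apply: Gnorm => u; rewrite -KE.
  rewrite -[normalized_step _ _](subrK (normalized_step (fun=> 0) (x, u))).
  rewrite addrC (le_trans (ler_normD _ _))// lerD//; first by rewrite step0.
  apply: normalized_step_dist => //; first exact: bQ.
  by move=> y; rewrite subr0; have [[_ ->]] := Qh.
have QG h : Q h -> Q (G (normalized_step h)).
  move=> Qh; split; last exact: (PG h (bQ _ Qh) Qh.2).
  split; last exact: stepK.
  by apply: mG; apply: bounded_normalized_step; exact: bQ.
have Gk h1 h2 e : Q h1 -> Q h2 -> (forall x, `|h1 x - h2 x| <= e) -> forall x,
    `|G (normalized_step h1) x - G (normalized_step h2) x| <= kappa * e.
  move=> Q1 Q2 h12 x; apply: Gdist => u.
  by apply: normalized_step_dist => //; exact: bQ.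
have Gb x : `|G (normalized_step (fun=> 0)) x - 0| <= K.
  by rewrite subr0; exact: stepK.
have [h Qh hE] := contraction_fixpoint kappa_ge0 kappa_lt1 Qcl QG Gk Q0 Gb.
by exists h; split => //; [exact: bQ|exact: Qh.2].
Qed.

Lemma policy_fixpoint (f : X -> U) : measurable_fun setT f ->
  exists2 h, bounded_measurable h &
    forall x, h x = normalized_step h (x, f x).
Proof.
move=> mf.
have [] // := @normalized_fixpoint (fun=> True) (fun a x => a (x, f x)).
  move=> a [ma _]; apply: (measurableT_comp ma).
  by apply: measurable_fun_pair => //; exact: measurable_id.
by move=> h [bh _ hE]; exists h.
Qed.

(** The modulus of continuity [w] passes to the fixed point because the
    operator preserves it. *)
Lemma bellman_fixpoint (u0 : U) (w : X -> X -> R) :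
  (forall x y, 0 <= w x y) ->
  (forall h, bounded_measurable h -> (forall x y, `|h x - h y| <= w x y) ->
    forall x y u,
      `|normalized_step h (x, u) - normalized_step h (y, u)| <= w x y) ->
  exists h, [/\ bounded_measurable h, forall x y, `|h x - h y| <= w x y &
    forall x, h x = min_action u0 (fun u => normalized_step h (x, u))].
Proof.
move=> w0 wstep.
apply: (@normalized_fixpoint _ (fun a x => min_action u0 (fun u => a (x, u)))).
- exact: pointwise_closed_modulus.
- by move=> x y; rewrite subrr normr0.
- by move=> a [ma _]; exact: measurable_min_action.
- by move=> a b x e ab; exact: min_action_dist.
- by [].
- by move=> h bh hw x y; apply: min_action_dist => u; exact: wstep.
Qed.

End normalized_operator.

(** * Lipschitz functions and the Wasserstein distance *)

Section lipschitz_functions.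
Context {R : realType}.

Lemma lipschitz_continuous (X : metricType R) (f : X -> R) (L : R) :
  (forall x y, `|f x - f y| <= L * mdist x y) -> continuous f.
Proof.
move=> fL x; apply/cvgrPdist_lt => e e0.
have L1 : 0 < `|L| + 1 by rewrite ltr_wpDl.
apply/nbhs_ballP; exists (e / (`|L| + 1)); first by rewrite /= divr_gt0.
move=> y; rewrite ballEmdist/= ltr_pdivlMr// => xy.
rewrite (le_lt_trans (fL x y))// (le_lt_trans _ xy)// mulrC.
by rewrite ler_wpM2l ?mdist_ge0// (le_trans (ler_norm L))// lerDl.
Qed.

Lemma lipschitz_measurable d (X : polishType R d) (f : X -> R) (L : R) :
  (forall x y, `|f x - f y| <= L * mdist x y) -> measurable_fun setT f.
Proof.
move=> /lipschitz_continuous/continuousP cf.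
move=> mT; move: mT; apply: (measurability _ (RGenOpens.measurableE R)).
move=> _ [_ [a [b ->] <-]]; rewrite setTI.
have : open (f @^-1` `]a, b[%classic) by apply: cf; exact: interval_open.
by rewrite borel_measurable; exact: sub_sigma_algebra.
Qed.

Lemma mdist_lipschitz (X : metricType R) (z x y : X) :
  `|mdist z x - mdist z y| <= 1 * mdist x y.
Proof.
rewrite mul1r ler_norml; apply/andP; split.
  have := metric_triangle z x y; lra.
by have := metric_triangle z y x; rewrite (metric_sym y x); lra.
Qed.

Lemma mdist_le_diameter (X : metricType R) (x y : X) :
  compact [set: X] -> mdist x y <= diameter X.
Proof.
move=> cX; apply: ub_le_sup; last by exists (x, y).
have cd : {within [set: X], continuous (mdist x)}.
  apply: continuous_subspaceT.
  exact: lipschitz_continuous (mdist_lipschitz x).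
have [M [_ MP]] := compact_bounded (continuous_compact cd cX).
have dM z : mdist x z <= `|M| + 1.
  rewrite -[leLHS]ger0_norm ?mdist_ge0//.
  by apply: (MP (`|M| + 1)); [rewrite ltr_pwDr// ler_norm|exists z].
exists (`|M| + 1 + (`|M| + 1)) => _ [[z t] _ <-] /=.
rewrite (le_trans (metric_triangle z x t))// lerD//.
by rewrite metric_sym.
Qed.

(** The infimal convolution of [f] with the cone [L d] is [L]-Lipschitz and lies
    below [f]; the hypothesis bounds how far below. *)
Lemma lipschitz_approximation (X : metricType R) (f : X -> R) (L e : R) :
  0 <= L ->
  (forall x y, f x - f y <= L * mdist x y + e) ->
  exists2 g : X -> R, (forall x y, `|g x - g y| <= L * mdist x y) &
    forall x, f x - e <= g x <= f x.
Proof.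
move=> L0 fL; pose g x := inf (range (fun y => f y + L * mdist x y)).
have lb x : lbound (range (fun y => f y + L * mdist x y)) (f x - e).
  by move=> _ [y _ <-]; have := fL x y; lra.
have g_le x y : g x <= f y + L * mdist x y.
  by apply: ge_inf; [exists (f x - e)|exists y].
have ge_g x r : (forall y, r <= f y + L * mdist x y) -> r <= g x.
  move=> rf; apply: lb_le_inf; first by exists (f x + L * mdist x x), x.
  by move=> _ [y _ <-].
have gL x y : g x - L * mdist x y <= g y.
  apply: ge_g => z; rewrite lerBlDr (le_trans (g_le x z))// -addrA lerD2l.
  by rewrite -mulrDr ler_wpM2l// addrC metric_triangle.
exists g => [x y|x].
  by rewrite ler_norml; have := gL x y; have := gL y x;
    rewrite (metric_sym y x) => ? ?; apply/andP; split; lra.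
apply/andP; split; first by apply: ge_g => y; have := fL x y; lra.
by have := g_le x x; rewrite mdistxx mulr0 addr0.
Qed.

End lipschitz_functions.

Lemma inhabited_mass1 {R : realType} {d} {S : measurableType d}
    (m : {measure set S -> \bar R}) : m setT = 1%E -> inhabited S.
Proof.
move=> m1; have [//|noS] := pselect (inhabited S).
suff : 1%E = 0%E :> \bar R by move=> /eqP; rewrite onee_eq0.
rewrite -m1 -(measure0 m); congr (m _); rewrite -subset0 => x.
by case: noS; split.
Qed.

Lemma probability_of_measure {R : realType} {d} {S : measurableType d}
    (m : {measure set S -> \bar R}) : m setT = 1%E ->
  exists P : probability S R, forall A, P A = m A.
Proof.
move=> m1; have [x] := inhabited_mass1 m1.
exists (mnormalize m (dirac x)) => A.
by rewrite /= /mnormalize m1/= onee_eq0 /= invr1 mule1.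
Qed.

Section wasserstein.
Context {R : realType} {d} {X : polishType R d}.
Implicit Types m : {measure set X -> \bar R}.

Import HBNNSimple.

(** The integral of a nonnegative function is a supremum over the simple
    functions below it, so it is monotone without measurability; this avoids
    proving that the distance is jointly measurable. *)
Lemma ge0_le_integral_nonmeasurable d' (S : measurableType d')
    (mu : {measure set S -> \bar R}) (f g : S -> \bar R) :
  (forall x, 0 <= f x)%E -> (forall x, f x <= g x)%E ->
  (\int[mu]_x f x <= \int[mu]_x g x)%E.
Proof.
move=> f0 fg; rewrite !ge0_integralTE//; last first.
  by move=> x; exact: le_trans (fg x).
apply: le_ereal_sup => _ [h /= hf <-]; exists h => // x.
exact: le_trans (fg x).
Qed.

Lemma coupling_marginals (m1 m2 : {measure set X -> \bar R}) g (f : X -> R) :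
  coupling m1 m2 g -> bounded_measurable f ->
  \int[m1]_x f x = \int[g]_p f p.1 /\ \int[m2]_x f x = \int[g]_p f p.2.
Proof.
move=> gm [mf [K fK]].
have bf : bounded_measurable f by split => //; exists K.
have gfin : (g setT < +oo)%E by rewrite probability_setT ltry.
have b1 : bounded_measurable (fun p : X * X => f p.1).
  exact: bounded_measurable_comp bf.
have b2 : bounded_measurable (fun p : X * X => f p.2).
  exact: bounded_measurable_comp bf.
split.
  rewrite /Rintegral (eq_measure_integral (pushforward g fst)).
  - rewrite integral_pushforward//=; first exact/measurable_EFinP.
    exact: bounded_measurable_integrable gfin b1.
  - move=> A mA _; rewrite -(gm A mA).1; congr (g _).
    by apply/seteqP; split => [[x y] []|[x y] ?] //.
rewrite /Rintegral (eq_measure_integral (pushforward g snd)).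
- rewrite integral_pushforward//=; first exact/measurable_EFinP.
  exact: bounded_measurable_integrable gfin b2.
- move=> A mA _; rewrite -(gm A mA).2; congr (g _).
  by apply/seteqP; split => [[x y] []|[x y] ?] //.
Qed.

Let lipschitz_W1_le_pos m1 m2 (f : X -> R) (L w : R) :
  bounded_measurable f -> 0 < L ->
  (forall x y, `|f x - f y| <= L * mdist x y) -> (W1 m1 m2 <= w%:E)%E ->
  `|\int[m1]_x f x - \int[m2]_x f x| <= L * w.
Proof.
move=> bf L0 fL Ww; rewrite mulrC -ler_pdivrMr// -lee_fin.
apply: le_trans Ww; apply: le_ereal_inf_tmp => _ [g gm <-].
have [-> ->] := coupling_marginals gm bf.
have gfin : (g setT < +oo)%E by rewrite probability_setT ltry.
have b1 : bounded_measurable (fun p : X * X => f p.1).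
  exact: bounded_measurable_comp bf.
have b2 : bounded_measurable (fun p : X * X => f p.2).
  exact: bounded_measurable_comp bf.
have b12 : bounded_measurable (fun p : X * X => `|f p.1 - f p.2|).
  have [m12 [K fK]] := bounded_measurableB b1 b2.
  by split; [exact: measurableT_comp|exists K => x; rewrite normr_id].
have i12 := bounded_measurable_integrable gfin b12.
apply: (@le_trans _ _ (\int[g]_p (`|f p.1 - f p.2| / L)%:E)%E); last first.
  apply: ge0_le_integral_nonmeasurable => p.
    by rewrite lee_fin divr_ge0// ltW.
  by rewrite lee_fin ler_pdivrMr// mulrC.
rewrite (_ : (\int[g]_p (`|f p.1 - f p.2| / L)%:E)%E =
  (\int[g]_p (`|f p.1 - f p.2| / L))%:E).
  rewrite lee_fin RintegralZr// ler_wpM2r ?invr_ge0 ?(ltW L0)//.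
  rewrite -RintegralB_bounded//; apply: le_normr_Rintegral => //.
  apply: bounded_measurable_integrable => //.
  exact: bounded_measurableB.
rewrite /Rintegral fineK//; apply: integrable_fin_num => //.
under eq_fun do rewrite EFinM.
by apply: (integrableZr measurableT L^-1 i12).
Qed.

Lemma W1_ge0 m1 m2 : (0 <= W1 m1 m2)%E.
Proof.
apply: le_ereal_inf_tmp => _ [g _ <-]; apply: integral_ge0 => p _.
by rewrite lee_fin mdist_ge0.
Qed.

(** The elementary half of Kantorovich duality. *)
Lemma lipschitz_W1_le m1 m2 (f : X -> R) (L w : R) :
  bounded_measurable f -> 0 <= L ->
  (forall x y, `|f x - f y| <= L * mdist x y) -> (W1 m1 m2 <= w%:E)%E ->
  `|\int[m1]_x f x - \int[m2]_x f x| <= L * w.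
Proof.
move=> bf L0 fL Ww; apply/ler_addgt0Pr => e e0.
have w0 : 0 <= w by rewrite -lee_fin (le_trans _ Ww)// W1_ge0.
have w1 : 0 < w + 1 by rewrite ltr_wpDl.
have ew0 : 0 < e / (w + 1) by rewrite divr_gt0.
apply: (@le_trans _ _ ((L + e / (w + 1)) * w)).
  apply: lipschitz_W1_le_pos => //; first by rewrite ltr_wpDl.
  move=> x y; rewrite (le_trans (fL x y))// mulrDl lerDl.
  by rewrite mulr_ge0 ?(ltW ew0) ?mdist_ge0.
rewrite mulrDl lerD2l mulrAC ler_pdivrMr// ler_wpM2l ?(ltW e0)//.
by rewrite lerDl.
Qed.

Lemma W1_le m1 m2 (D : R) : m1 setT = 1%E -> m2 setT = 1%E ->
  (forall x y : X, mdist x y <= D) -> (W1 m1 m2 <= D%:E)%E.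
Proof.
move=> m1T m2T dD.
have [P1 P1E] := probability_of_measure m1T.
have [P2 P2E] := probability_of_measure m2T.
have [g gm] : exists g, coupling m1 m2 g.
  exists (P1 \x P2)%E => A mA.
  have PE := fun B C mB mC => @product_measure1E _ _ _ _ R P1 P2 B C mB mC.
  split.
    rewrite -[RHS]mule1 -m2T -P1E -P2E.
    exact: PE mA measurableT.
  rewrite -[RHS]mul1e -m1T -P1E -P2E.
  exact: PE measurableT mA.
apply: (@le_trans _ _ (\int[g]_p (mdist p.1 p.2)%:E)%E).
  by apply: ereal_inf_lbound; exists g.
apply: (@le_trans _ _ (\int[g]_p D%:E)%E).
  by apply: ge0_le_integral_nonmeasurable => p; rewrite lee_fin// mdist_ge0.
by rewrite integral_cst//= [X in (_ * X)%E](probability_setT g) mule1.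
Qed.

End wasserstein.

(** * Hoelder functions and the Wasserstein distance *)

Section powR_facts.
Context {R : realType}.
Implicit Types (a t delta : R).

(** The concave function [t |-> t^delta] lies below its tangent at [a].  With
    [t / a = exp s] this is the convexity of [exp], obtained by averaging its
    tangent at [delta s], evaluated at [s] and at [0], with weights [delta] and
    [1 - delta]. *)
Lemma powR_le_tangent a t delta : 0 < a -> 0 <= t -> 0 < delta -> delta <= 1 ->
  t `^ delta <= a `^ delta * (delta * (t / a) + (1 - delta)).
Proof.
move=> a0 t0 d0 d1.
have [->|tN0] := eqVneq t 0.
  rewrite powR0 ?gt_eqF// mul0r mulr0 add0r mulr_ge0 ?powR_ge0//.
  by rewrite subr_ge0.
have tp : 0 < t by rewrite lt_neqAle eq_sym tN0.
have ta0 : 0 < t / a by rewrite divr_gt0.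
have -> : t `^ delta = a `^ delta * (t / a) `^ delta.
  by rewrite -powRM ?ltW// mulrC divfK// gt_eqF.
rewrite ler_wpM2l ?powR_ge0//.
set s := ln (t / a).
have taE : t / a = expR s by rewrite lnK// posrE.
have -> : (t / a) `^ delta = expR (delta * s) by rewrite /powR gt_eqF.
set v := expR (delta * s).
have v0 : 0 <= v by exact: expR_ge0.
have h1 : v * (1 + (1 - delta) * s) <= t / a.
  rewrite (le_trans (ler_wpM2l v0 (expR_ge1Dx _)))// -expRD taE.
  by rewrite -mulrDl addrC subrK mul1r.
have h2 : v * (1 - delta * s) <= 1.
  rewrite (le_trans (ler_wpM2l v0 (expR_ge1Dx _)))// -expRD.
  by rewrite subrr expR0.
have -> : v = delta * (v * (1 + (1 - delta) * s)) +
    (1 - delta) * (v * (1 - delta * s)) by ring.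
rewrite lerD// ?ler_wpM2l ?(ltW d0)//.
by rewrite -[leRHS]mulr1 ler_wpM2l// subr_ge0.
Qed.

Lemma powR_split t delta : 0 < t -> t = t `^ (1 - delta) * t `^ delta.
Proof.
move=> t0; rewrite -powRD ?subrK ?powRr1 ?ltW//.
by apply/implyP => _; rewrite gt_eqF.
Qed.

End powR_facts.

Section hoelder_estimate.
Context {R : realType} {d} {X : polishType R d}.
Variables (m1 m2 nu : {measure set X -> \bar R}).
Hypotheses (m1T : m1 setT = 1%E) (m2T : m2 setT = 1%E).
Hypothesis num1 : forall A, measurable A -> (nu A <= m1 A)%E.
Hypothesis num2 : forall A, measurable A -> (nu A <= m2 A)%E.
Let kappa := 1 - fine (nu setT).
Hypothesis kappa_gt0 : 0 < kappa.
Variables (f : X -> R) (C delta : R).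
Hypotheses (bf : bounded_measurable f) (C0 : 0 <= C).
Hypotheses (delta_gt0 : 0 < delta) (delta_le1 : delta <= 1).
Hypothesis fC : forall x y, `|f x - f y| <= C * mdist x y `^ delta.

Let fin1 : (m1 setT < +oo)%E. Proof. by rewrite m1T ltry. Qed.
Let fin2 : (m2 setT < +oo)%E. Proof. by rewrite m2T ltry. Qed.

(** The tangent to [t^delta] at [a] turns the Hoelder condition into
    [f x - f y <= L d(x,y) + e], hence [g <= f <= g + e] for an [L]-Lipschitz
    [g].  The integrals of [g] differ by at most [L w]; those of [f - g], whose
    values lie in [[0, e]], differ by at most [kappa e], since the parts
    integrated against [nu] cancel.  The choice [a = w / kappa] minimizes the
    sum [L w + kappa e]. *)
Lemma hoelder_W1_le_pos (w : R) : 0 < w -> (W1 m1 m2 <= w%:E)%E ->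
  `|\int[m1]_x f x - \int[m2]_x f x| <= C * (kappa * (w / kappa) `^ delta).
Proof.
move=> w0 Ww.
pose a := w / kappa; have a0 : 0 < a by rewrite divr_gt0.
have ad0 : 0 < a `^ delta by rewrite powR_gt0.
pose L := C * (a `^ delta * (delta / a)).
have L0 : 0 <= L by rewrite mulr_ge0// mulr_ge0 ?divr_ge0// ltW.
pose e := C * (a `^ delta * (1 - delta)).
have [x y|g gL gf] := @lipschitz_approximation R X f L e L0.
  rewrite (le_trans (ler_norm _))// (le_trans (fC x y))//.
  have := powR_le_tangent a0 (mdist_ge0 x y) delta_gt0 delta_le1.
  move=> /(ler_wpM2l C0)/le_trans; apply; rewrite /L /e.
  by rewrite le_eqVlt; apply/orP; left; apply/eqP; ring.
have bg : bounded_measurable g.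
  split; first exact: lipschitz_measurable gL.
  have [_ [K fK]] := bf; exists (K + e) => x.
  have := gf x; have := fK x; rewrite !ler_norml.
  by move=> /andP[? ?] /andP[? ?]; apply/andP; split; lra.
have gW := lipschitz_W1_le bg L0 gL Ww.
have bfg := bounded_measurableB bf bg.
have fg0 x : 0 <= f x - g x by have /andP[_ ?] := gf x; rewrite subr_ge0.
have fge x : f x - g x <= e by have /andP[? _] := gf x; lra.
have lo1 := ge0_le_measure_Rintegral fin1 num1 bfg fg0.
have lo2 := ge0_le_measure_Rintegral fin2 num2 bfg fg0.
have up1 := minorized_Rintegral_le m1T num1 bfg fge.
have up2 := minorized_Rintegral_le m2T num2 bfg fge.
have d1 := RintegralB_bounded fin1 bf bg.
have d2 := RintegralB_bounded fin2 bf bg.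
have -> : C * (kappa * (w / kappa) `^ delta) = L * w + kappa * e.
  rewrite -/a /L /e (_ : w = a * kappa); last by rewrite /a divfK// gt_eqF.
  by field; rewrite gt_eqF.
rewrite -/kappa in up1 up2.
move: gW; rewrite !ler_norml => /andP[? ?]; apply/andP; split; lra.
Qed.

(** The case [w = 0] follows by letting the bound tend to [0]. *)
Lemma hoelder_W1_le (w : R) : 0 <= w -> (W1 m1 m2 <= w%:E)%E ->
  `|\int[m1]_x f x - \int[m2]_x f x| <= C * (kappa * (w / kappa) `^ delta).
Proof.
rewrite le_eqVlt => /predU1P[<- Ww|]; last exact: hoelder_W1_le_pos.
rewrite mul0r powR0 ?gt_eqF// mulr0 mulr0.
have to0 : C * (kappa * a `^ delta) @[a --> 0^'+] --> (0 : R).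
  rewrite -[X in _ --> X](mulr0 (C * kappa)); under eq_fun do rewrite mulrA.
  by apply: cvgMr; exact: powR_cvg0.
apply: (cvgr_to_ge to0); near=> a.
have a0 : 0 < a by [].
rewrite -[a in leRHS](mulfK (lt0r_neq0 kappa_gt0)).
apply: hoelder_W1_le_pos; first by rewrite mulr_gt0.
by rewrite (le_trans Ww)// lee_fin ltW// mulr_gt0.
Unshelve. all: by end_near. Qed.

End hoelder_estimate.

(** * Optimality equations and their perturbation *)

Section optimality.
Context {R : realType} {dX dU : measure_display}
  {X : measurableType dX} {U : finDiscreteType dU}.
Context (T : R.-pker (X * U) ~> X) (c : X * U -> R).
Context (nu : {measure set X -> \bar R}).
Hypothesis bc : bounded_measurable c.

Lemma one_step_normalized h xu :
  one_step T c h xu = \int[nu]_y h y + normalized_step T c nu h xu.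
Proof. by rewrite addrC subrK. Qed.

Lemma opt_avg_cost_bellman h : bounded_measurable h -> forall u0 : U,
  (forall x, h x = min_action u0 (fun u => normalized_step T c nu h (x, u))) ->
  forall x, opt_avg_cost T c x = (\int[nu]_y h y)%:E.
Proof.
move=> bh u0 hE x; apply/eqP; rewrite eq_le; apply/andP; split.
  have [f mf fmin] :=
    measurable_minimizer u0 (bounded_normalized_step T nu bc bh).1.
  apply: (@le_trans _ _ (avg_cost T c (stationary mf) x)).
    by apply: ereal_inf_lbound; exists (stationary mf).
  apply: (stationary_avg_cost_le bc bh) => y.
  rewrite one_step_normalized lerD2l hE.
  by rewrite (@min_action_unique _ _ _ u0
    (fun u => normalized_step T c nu h (y, u)) (f y)).
apply: (opt_avg_cost_ge bc bh) => y u.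
rewrite one_step_normalized lerD2l hE.
exact: (min_action_le u0 (fun u => normalized_step T c nu h (y, u))).
Qed.

Lemma stationary_avg_costE g (f : X -> U) (mf : measurable_fun setT f) :
  bounded_measurable g -> (forall x, g x = normalized_step T c nu g (x, f x)) ->
  forall x, avg_cost T c (stationary mf) x = (\int[nu]_y g y)%:E.
Proof.
move=> bg gE x; apply/eqP; rewrite eq_le; apply/andP; split.
  apply: (stationary_avg_cost_le bc bg) => y.
  by rewrite one_step_normalized -gE.
by apply: (stationary_avg_cost_ge bc bg) => y; rewrite one_step_normalized -gE.
Qed.

End optimality.

Section normalized_acoe.
Context {R : realType} {dX dU : measure_display}
  {X : measurableType dX} {U : finDiscreteType dU}.
Context (T : R.-pker (X * U) ~> X) (c : X * U -> R).
Context (nu : {measure set X -> \bar R}).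

(** Adding a constant to a solution of the optimality equation keeps it a
    solution; the constant is chosen so that [int h dnu] becomes the average
    cost, which is possible because [nu] has positive mass. *)
Lemma satisfies_acoe_normalized (f : X -> U) :
  (nu setT < +oo)%E -> fine (nu setT) != 0 -> satisfies_acoe T c f ->
  exists h, [/\ bounded_measurable h,
    forall x, h x = normalized_step T c nu h (x, f x) &
    forall x u, h x <= normalized_step T c nu h (x, u)].
Proof.
move=> nufin nu0 [r [h [mh [K hK] hE]]].
have bh : bounded_measurable h by split => //; exists K.
pose s := (r - \int[nu]_y h y) / fine (nu setT).
have bs := @bounded_measurable_cst R _ X s.
pose h' x := h x + s.
have nuh' : \int[nu]_y h' y = r.
  by rewrite RintegralD_bounded// Rintegral_cst// /s divfK// addrC subrK.
have step' x u : normalized_step T c nu h' (x, u) = acoe_rhs T c h x u + s - r.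
  rewrite /normalized_step nuh' /one_step RintegralD_bounded//.
    by rewrite (Rintegral_cstT _ (prob_kernel (x, u))) addrA.
  exact: prob_kernel_fin.
exists h'; split; first exact: bounded_measurableD.
- by move=> x; rewrite step' -(hE x).1 /h'; ring.
- move=> x u; rewrite step' /h'.
  suff : r + h x <= acoe_rhs T c h x u by lra.
  by rewrite (hE x).2; exact: bigmin_le.
Qed.

End normalized_acoe.

Section perturbation.
Context {R : realType} {dX dU : measure_display}
  {X : measurableType dX} {U : finDiscreteType dU}.
Context (T T' : R.-pker (X * U) ~> X) (c c' : X * U -> R).
Context (nu : {measure set X -> \bar R}).
Hypothesis nuT' : forall A xu, measurable A -> (nu A <= T' xu A)%E.
Let kappa := 1 - fine (nu setT).
Hypotheses (kappa_ge0 : 0 <= kappa) (kappa_lt1 : kappa < 1).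

(** Put [S = sup |h - h'|].  Comparing [h] and [h'] at the greedy action of one
    and then of the other gives [S <= e + kappa S].  At the action of [f'] one
    passes from the operator of [h] to that of [h'], where it is optimal, and
    back from [h'] to [h]: the total error is [(e + kappa S) + S]. *)
Lemma bellman_perturbation h h' (f f' : X -> U) e :
  bounded_measurable h -> bounded_measurable h' ->
  (forall x, h x = normalized_step T c nu h (x, f x)) ->
  (forall x u, h x <= normalized_step T c nu h (x, u)) ->
  (forall x, h' x = normalized_step T' c' nu h' (x, f' x)) ->
  (forall x u, h' x <= normalized_step T' c' nu h' (x, u)) ->
  (forall xu, `|normalized_step T c nu h xu - normalized_step T' c' nu h xu|
    <= e) ->
  forall x, normalized_step T c nu h (x, f' x) <= h x + 2 / (1 - kappa) * e.
Proof.
move=> bh bh' hE hle h'E h'le he x0.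
have kappa1 : 0 < 1 - kappa by rewrite subr_gt0.
have step_dist b : (forall x, `|h x - h' x| <= b) -> forall xu,
    `|normalized_step T c nu h xu - normalized_step T' c' nu h' xu|
    <= e + kappa * b.
  move=> hb xu; rewrite -[_ - _](subrKA (normalized_step T' c' nu h xu)).
  rewrite (le_trans (ler_normD _ _))// lerD//.
  exact: normalized_step_dist.
have h_dist b : (forall x, `|h x - h' x| <= b) ->
    forall x, `|h x - h' x| <= e + kappa * b.
  move=> /step_dist hb x; rewrite ler_norml.
  have := hb (x, f x); have := hb (x, f' x); rewrite !ler_norml.
  have := hE x; have := h'E x; have := hle x (f' x); have := h'le x (f x).
  by move=> ? ? ? ? /andP[? ?] /andP[? ?]; apply/andP; split; lra.
pose S := sup (range (fun x => `|h x - h' x|)).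
have [_ [K hK]] := bounded_measurableB bh bh'.
have hS x : `|h x - h' x| <= S.
  apply: ub_le_sup; last by exists x.
  by exists K => _ [y _ <-]; exact: hK.
have SE : S <= e + kappa * S.
  apply: ge_sup; first by exists `|h x0 - h' x0|, x0.
  by move=> _ [y _ <-]; exact: h_dist.
have S_le : S <= e / (1 - kappa) by rewrite ler_pdivlMr//; lra.
have eE : e = (1 - kappa) * (e / (1 - kappa)) by rewrite mulrC divfK// gt_eqF.
have := step_dist _ hS (x0, f' x0); have := hS x0; have := h'E x0.
rewrite (_ : 2 / (1 - kappa) * e = 2 * (e / (1 - kappa))); last by ring.
rewrite !ler_norml => ? /andP[? ?] /andP[? ?].
have : kappa * S <= kappa * (e / (1 - kappa)) by rewrite ler_wpM2l.
lra.
Qed.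

End perturbation.

Lemma approx_kernel_minorized {R : realType} {dX dU : measure_display}
    {X : measurableType dX} {U : finDiscreteType dU}
    (Q : quantization R X) (T : R.-pker (X * U) ~> X)
    (nu : {measure set X -> \bar R}) :
  (forall A xu, measurable A -> (nu A <= T xu A)%E) ->
  forall A xu, measurable A -> (nu A <= approx_kernel Q T xu A)%E.
Proof.
move=> nuT A xu mA; have mB := @measurable_bin _ _ _ Q (bin_of Q xu.1).
apply: (@le_trans _ _
    (\int[bin_weight (bin_of Q xu.1)]_(z in bin (bin_of Q xu.1)) nu A)%E).
  by rewrite integral_cst// [X in (_ <= _ * X)%E]bin_weight_bin mule1.
apply: ge0_le_integral => //.
  apply: measurable_funTS.
  apply: (measurableT_comp (measurable_kernel T A mA)).
  exact: pair2_measurable.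
by move=> z _; exact: nuT.
Qed.

Section lipschitz_model.
Context {R : realType} {dX dU : measure_display}
  {X : polishType R dX} {U : finDiscreteType dU}.
Context (T : R.-pker (X * U) ~> X) (c : X * U -> R).
Context (nu : {measure set X -> \bar R}).
Hypothesis nuT : forall A xu, measurable A -> (nu A <= T xu A)%E.
Let kappa := 1 - fine (nu setT).
Hypotheses (kappa_gt0 : 0 < kappa) (kappa_lt1 : kappa < 1).
Hypothesis compactX : compact [set: X].
Variables (Kc KT delta : R).
Hypotheses (Kc_ge0 : 0 <= Kc) (KT_ge0 : 0 <= KT).
Hypothesis lipschitz_cost :
  forall x y u, `|c (x, u) - c (y, u)| <= Kc * mdist x y.
Hypothesis lipschitz_kernel :
  forall x y u, (W1 (T (x, u)) (T (y, u)) <= (KT * mdist x y)%:E)%E.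
Hypotheses (delta_gt0 : 0 < delta) (delta_le1 : delta <= 1).
Hypothesis KT_lt : KT < kappa^-1 `^ ((1 - delta) / delta).

Lemma lipschitz_cost_bounded : bounded_measurable c.
Proof.
split.
  apply: measurable_sections => u.
  exact: (lipschitz_measurable (fun x y => lipschitz_cost x y u)).
have [[x0]|noX] := pselect (inhabited X); last first.
  by exists 0 => -[x u]; case: noX; split.
exists (\sum_(u : U) `|c (x0, u)| + Kc * diameter X) => -[x u].
rewrite -[c _](subrK (c (x0, u))) addrC (le_trans (ler_normD _ _))// lerD//.
  by rewrite (bigD1 u)//= lerDl sumr_ge0.
by rewrite (le_trans (lipschitz_cost _ _ _))// ler_wpM2l// mdist_le_diameter.
Qed.

(** The hypothesis on [KT], raised to the power [delta] after division by
    [kappa]: [kappa^-1 * kappa^-((1 - delta) / delta)] is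
    [kappa^-(1 / delta)]. *)
Lemma hoelder_ratio_lt1 : kappa * (KT / kappa) `^ delta < 1.
Proof.
have k0 : 0 <= kappa^-1 by rewrite invr_ge0 ltW.
rewrite -ltr_pdivlMl// mulr1.
rewrite [ltRHS](_ : _ =
    (kappa^-1 `^ ((1 - delta) / delta) * kappa^-1) `^ delta);
    last first.
  rewrite powRM ?powR_ge0// -powRrM divfK ?gt_eqF//.
  by rewrite -powR_split// invr_gt0.
apply: gt0_ltr_powR => //.
- by rewrite nnegrE; exact: divr_ge0 KT_ge0 (ltW kappa_gt0).
- by rewrite nnegrE; exact: mulr_ge0 (powR_ge0 _ _) k0.
- by rewrite ltr_pM2r// invr_gt0.
Qed.

(** The solution of [C = Kc D^(1-delta) + C kappa (KT / kappa)^delta], where the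
    right-hand side is the Hoelder constant of the image under the normalized
    operator of a function of Hoelder constant [C]. *)
Definition hoelder_constant : R :=
  Kc * diameter X `^ (1 - delta) / (1 - kappa * (KT / kappa) `^ delta).

Lemma hoelder_constant_ge0 : 0 <= hoelder_constant.
Proof.
rewrite /hoelder_constant divr_ge0// ?mulr_ge0 ?powR_ge0//.
by rewrite subr_ge0 ltW// hoelder_ratio_lt1.
Qed.

Lemma normalized_step_hoelder h : bounded_measurable h ->
  (forall x y, `|h x - h y| <= hoelder_constant * mdist x y `^ delta) ->
  forall x y u, `|normalized_step T c nu h (x, u) -
    normalized_step T c nu h (y, u)| <= hoelder_constant * mdist x y `^ delta.
Proof.
move=> bh hC x y u; set C := hoelder_constant.
set r := kappa * (KT / kappa) `^ delta.
have r1 : 0 < 1 - r by rewrite subr_gt0 hoelder_ratio_lt1.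
have CE : C = Kc * diameter X `^ (1 - delta) + C * r.
  by rewrite /C /hoelder_constant -/r; field; rewrite gt_eqF.
have cost_le : `|c (x, u) - c (y, u)| <=
    Kc * diameter X `^ (1 - delta) * mdist x y `^ delta.
  rewrite (le_trans (lipschitz_cost x y u))// -mulrA ler_wpM2l//.
  have := mdist_ge0 x y; rewrite le_eqVlt => /predU1P[<-|d0].
    by rewrite mulr_ge0 ?powR_ge0.
  rewrite [leLHS](powR_split delta d0) ler_wpM2r ?powR_ge0//.
  by apply: ge0_ler_powR; rewrite ?subr_ge0// ?nnegrE ?(ltW d0)//;
    rewrite ?(le_trans (ltW d0)) ?mdist_le_diameter.
have kernel_le : `|\int[T (x, u)]_z h z - \int[T (y, u)]_z h z| <=
    C * r * mdist x y `^ delta.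
  have := hoelder_W1_le (prob_kernel (x, u)) (prob_kernel (y, u))
    (fun A mA => nuT (x, u) mA) (fun A mA => nuT (y, u) mA) kappa_gt0 bh
    hoelder_constant_ge0 delta_gt0 delta_le1 hC
    (mulr_ge0 KT_ge0 (mdist_ge0 x y)) (lipschitz_kernel x y u).
  rewrite -/kappa -/C (_ : KT * _ / _ = KT / kappa * mdist x y); last first.
    by rewrite mulrAC.
  by rewrite powRM ?mdist_ge0 ?divr_ge0 ?(ltW kappa_gt0)// /r !mulrA.
rewrite [in leRHS]CE mulrDl (le_trans _ (lerD cost_le kernel_le))//.
rewrite (le_trans _ (ler_normD _ _))// /normalized_step /one_step.
by rewrite le_eqVlt; apply/orP; left; apply/eqP; congr (`|_|); ring.
Qed.

Lemma kernel_integral_loss_le h (T' : R.-pker (X * U) ~> X) xu w :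
  (forall A xu, measurable A -> (nu A <= T' xu A)%E) ->
  bounded_measurable h ->
  (forall x y, `|h x - h y| <= hoelder_constant * mdist x y `^ delta) ->
  0 <= w -> (W1 (T xu) (T' xu) <= w%:E)%E ->
  `|\int[T xu]_y h y - \int[T' xu]_y h y| <=
  hoelder_constant * (kappa * (w / kappa) `^ delta).
Proof.
move=> nuT' bh hC w0 Ww.
exact: (hoelder_W1_le (prob_kernel xu) (prob_kernel xu)
  (fun A mA => nuT xu mA) (fun A mA => nuT' _ xu mA) kappa_gt0 bh
  hoelder_constant_ge0 delta_gt0 delta_le1 hC).
Qed.

(** The losses enter through real upper bounds [ec] and [w], so that extended
    real suprema are dealt with only once. *)
Lemma approximate_policy_loss (Q : quantization R X) (pihat : X -> U)
    (mpihat : measurable_fun setT pihat) :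
  satisfies_acoe (approx_kernel Q T) (approx_cost Q c) pihat ->
  exists rho_pihat rho : R,
    [/\ forall x, avg_cost T c (stationary mpihat) x = rho_pihat%:E,
        forall x, opt_avg_cost T c x = rho%:E &
        forall ec w, (forall xu, loss_cost Q c xu <= ec) -> 0 <= w ->
          (forall xu, loss_kernel Q T xu <= w%:E)%E ->
          rho_pihat - rho <= 2 / (1 - kappa) *
            (ec + hoelder_constant * (kappa * (w / kappa) `^ delta))].
Proof.
move=> acoe; have [x0] := inhabited_mass1 (probability_setT (weight Q)).
pose u0 := pihat x0.
have bc := lipschitz_cost_bounded.
have k0 := ltW kappa_gt0.
have nufin : (nu setT < +oo)%E.
  exact: (dominated_fin (prob_kernel_fin T (x0, u0))
    (fun A mA => nuT (x0, u0) mA)).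
have [|h [bh hC hE]] := @bellman_fixpoint _ _ _ _ _ T c nu bc nuT k0
    kappa_lt1 u0 (fun x y => hoelder_constant * mdist x y `^ delta) _
    normalized_step_hoelder.
  by move=> x y; rewrite mulr_ge0 ?powR_ge0 ?hoelder_constant_ge0.
have [g bg gE] := policy_fixpoint bc nuT k0 kappa_lt1 mpihat.
have rhoE := opt_avg_cost_bellman bc bh hE.
have rho_piE := stationary_avg_costE bc mpihat bg gE.
exists (\int[nu]_y g y), (\int[nu]_y h y); split => // ec w cec w0 Tw.
have nu0 : fine (nu setT) != 0.
  by apply: contra_ltN kappa_lt1 => /eqP nu0; rewrite /kappa nu0 subr0.
have nuT' := approx_kernel_minorized Q nuT.
have [h' [bh' h'E h'le]] := satisfies_acoe_normalized nufin nu0 acoe.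
have [f _ fmin] :=
  measurable_minimizer u0 (bounded_normalized_step T nu bc bh).1.
have hf x : h x = normalized_step T c nu h (x, f x).
  by rewrite {1}hE (@min_action_unique _ _ _ u0
    (fun u => normalized_step T c nu h (x, u)) (f x)).
have hle x u : h x <= normalized_step T c nu h (x, u).
  rewrite {1}hE.
  exact: (min_action_le u0 (fun u => normalized_step T c nu h (x, u))).
pose e := ec + hoelder_constant * (kappa * (w / kappa) `^ delta).
have he xu : `|normalized_step T c nu h xu -
    normalized_step (approx_kernel Q T) (approx_cost Q c) nu h xu| <= e.
  have kernel_le := kernel_integral_loss_le nuT' bh hC w0 (Tw xu).
  rewrite (le_trans _ (lerD (cec xu) kernel_le))//.
  rewrite (le_trans _ (ler_normD _ _))// /normalized_step /one_step.
  by rewrite le_eqVlt; apply/orP; left; apply/eqP; congr (`|_|); ring.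
have sub := bellman_perturbation nuT' k0 kappa_lt1 bh bh' hf hle h'E h'le he.
rewrite lerBlDl -lee_fin -(rho_piE x0).
apply: (stationary_avg_cost_le bc bh) => x.
by rewrite (one_step_normalized T c nu) -addrA lerD2l addrC; exact: sub.
Qed.

End lipschitz_model.

(** * The performance bound *)

Lemma powR_rescale {R : realType} (kappa w delta : R) :
  0 < kappa -> 0 <= w ->
  kappa * (w / kappa) `^ delta = kappa `^ (1 - delta) * w `^ delta.
Proof.
move=> k0 w0; have wk0 : 0 <= w / kappa := divr_ge0 w0 (ltW k0).
rewrite {1}(powR_split delta k0) -mulrA -(powRM delta (ltW k0) wk0).
by rewrite mulrCA divff ?mulr1// gt_eqF.
Qed.

Lemma sup_norm_ge {R : realType} (A : Type) (f : A -> \bar R) a :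
  (`|f a| <= sup_norm f)%E.
Proof. by apply: ereal_sup_ubound; exists a. Qed.

Theorem theorem11 (R : realType) (dX dU : measure_display)
    (X : polishType R dX) (U : finDiscreteType dU)
    (T : R.-pker (X * U) ~> X) (c : X * U -> R) (Q : quantization R X)
    (* Minorization Condition *)
    (nu : {measure set X -> \bar R})
    (nu_gt0 : (0 < nu setT)%E)
    (minorization : forall (B : set X) (xu : X * U), measurable B ->
       (nu B <= T xu B)%E)
    (kappa : R) (kappaE : kappa = 1 - fine (nu setT)) (kappa_gt0 : 0 < kappa)
    (* Lipschitz Condition *)
    (compactX : compact [set: X])
    (Kc KT : R)
    (lipschitz_cost : forall (x x' : X) (u : U),
       `|c (x, u) - c (x', u)| <= Kc * mdist x x')
    (lipschitz_kernel : forall (x x' : X) (u : U),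
       (W1 (T (x, u)) (T (x', u)) <= (KT * mdist x x')%:E)%E)
    (delta : R) (delta_gt0 : 0 < delta) (delta_le1 : delta <= 1)
    (KT_lt : KT < kappa^-1 `^ ((1 - delta) / delta))
    (* the policy obtained from the approximate model *)
    (pihat : X -> U) (mpihat : measurable_fun setT pihat)
    (pihat_optimal :
       optimal_policy (approx_kernel Q T) (approx_cost Q c)
         (stationary mpihat))
    (pihat_acoe : satisfies_acoe (approx_kernel Q T) (approx_cost Q c) pihat) :
  exists rho_pihat rho : R,
    [/\ forall x0 : X, avg_cost T c (stationary mpihat) x0 = rho_pihat%:E,
        forall x0 : X, opt_avg_cost T c x0 = rho%:E &
        ((rho_pihat - rho)%:E <=
         (2 / (1 - kappa))%:E *
         (sup_norm (fun xu => (loss_cost Q c xu)%:E) +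
          (Kc * diameter X `^ (1 - delta) * kappa `^ (1 - delta)
             / (1 - kappa * (KT / kappa) `^ delta))%:E *
          sup_norm (loss_kernel Q T) `^ delta))%E].
Proof.
have [x0] := inhabited_mass1 (probability_setT (weight Q)).
have u0 := pihat x0.
have nuT A xu : measurable A -> (nu A <= T xu A)%E by exact: minorization.
have nufin : (nu setT < +oo)%E.
  exact: (dominated_fin (prob_kernel_fin T (x0, u0)) (fun A => nuT A (x0, u0))).
have kappa_lt1 : kappa < 1.
  by rewrite kappaE gtrBl fine_gt0// nu_gt0 nufin.
have mdistD x y := mdist_le_diameter x y compactX.
have loss_ge0 : (0 <= sup_norm (loss_kernel Q T))%E.
  exact: le_trans (abse_ge0 _) (sup_norm_ge _ (x0, u0)).
have W_le D : (forall x y : X, mdist x y <= D) ->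
    (sup_norm (loss_kernel Q T) <= D%:E)%E.
  move=> dD; apply: ge_ereal_sup => _ [xu _ <-]; rewrite gee0_abs ?W1_ge0//.
  by apply: W1_le => //; exact: prob_kernel.
pose w := fine (sup_norm (loss_kernel Q T)).
have wE : sup_norm (loss_kernel Q T) = w%:E.
  by rewrite fineK// ge0_fin_numE// (le_lt_trans (W_le _ mdistD))// ltry.
have w0 : 0 <= w by rewrite fine_ge0.
have lossw xu : (loss_kernel Q T xu <= w%:E)%E.
  by rewrite -wE; exact: le_trans (lee_abs _) (sup_norm_ge _ xu).
pose C := Kc * diameter X `^ (1 - delta) / (1 - kappa * (KT / kappa) `^ delta).
(* It is enough to treat real bounds on the losses: an infinite cost loss
   makes the right-hand side infinite. *)
suff [rho_pihat [rho [piE optE bound]]] : exists rho_pihat rho : R,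
    [/\ forall x, avg_cost T c (stationary mpihat) x = rho_pihat%:E,
        forall x, opt_avg_cost T c x = rho%:E &
        forall ec, (forall xu, loss_cost Q c xu <= ec) ->
          rho_pihat - rho <= 2 / (1 - kappa) *
            (ec + C * (kappa * (w / kappa) `^ delta))].
  exists rho_pihat, rho; split => //; rewrite wE poweR_EFin -EFinM.
  have -> : Kc * diameter X `^ (1 - delta) * kappa `^ (1 - delta) /
      (1 - kappa * (KT / kappa) `^ delta) * w `^ delta =
      C * (kappa * (w / kappa) `^ delta).
    by rewrite (powR_rescale _ kappa_gt0 w0) /C; ring.
  have k2 : 0 < 2 / (1 - kappa) by rewrite divr_gt0// subr_gt0.
  have [fin|/negbTE] := boolP (sup_norm (fun xu => (loss_cost Q c xu)%:E)
      \is a fin_num).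
    rewrite -(fineK fin) -EFinD -EFinM lee_fin; apply: bound => xu.
    rewrite -lee_fin fineK//.
    exact: le_trans (lee_abs _)
      (sup_norm_ge (fun xu => (loss_cost Q c xu)%:E) xu).
  rewrite ge0_fin_numE; last first.
    exact: le_trans (abse_ge0 _)
      (sup_norm_ge (fun xu => (loss_cost Q c xu)%:E) (x0, u0)).
  rewrite ltey => /negbFE/eqP ->.
  by rewrite addye// gt0_muley ?lte_fin// leey.
subst kappa.
(* Two distinct points force [Kc] and [KT] to be nonnegative.  On a one-point
   space they may be negative, but there the distance and the kernel loss
   vanish and both constants can be replaced by [0]. *)
have [[x [y xy]]|one_point] := pselect (exists x y : X, x <> y).
  have d0 : 0 < mdist x y by rewrite mdist_gt0; exact/eqP.
  have Kc_ge0 : 0 <= Kc.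
    rewrite -(pmulr_lge0 _ d0).
    exact: le_trans (normr_ge0 _) (lipschitz_cost x y u0).
  have KT_ge0 : 0 <= KT.
    rewrite -(pmulr_lge0 _ d0) -lee_fin.
    exact: le_trans (W1_ge0 _ _) (lipschitz_kernel x y u0).
  have [rho_pihat [rho [piE optE bound]]] :=
    approximate_policy_loss nuT kappa_gt0 kappa_lt1 compactX Kc_ge0 KT_ge0
      lipschitz_cost lipschitz_kernel delta_gt0 delta_le1 KT_lt mpihat
      pihat_acoe.
  by exists rho_pihat, rho; split => // ec cec; exact: bound.
have mdist_0 (x y : X) : mdist x y = 0.
  have [->|xy] := pselect (x = y); first exact: mdistxx.
  by case: one_point; exists x, y.
have w_eq0 : w = 0.
  apply/eqP; rewrite eq_le w0 andbT -lee_fin -wE; apply: W_le => x y.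
  by rewrite mdist_0.
have cost0 x y u : `|c (x, u) - c (y, u)| <= 0 * mdist x y.
  by rewrite (le_trans (lipschitz_cost x y u))// mdist_0 !mulr0.
have kernel0 x y u : (W1 (T (x, u)) (T (y, u)) <= (0 * mdist x y)%:E)%E.
  by rewrite (le_trans (lipschitz_kernel x y u))// mdist_0 !mulr0.
have K0_lt : 0 < (1 - fine (nu setT))^-1 `^ ((1 - delta) / delta).
  by rewrite powR_gt0// invr_gt0.
have [rho_pihat [rho [piE optE bound]]] :=
  approximate_policy_loss nuT kappa_gt0 kappa_lt1 compactX (lexx 0) (lexx 0)
    cost0 kernel0 delta_gt0 delta_le1 K0_lt mpihat pihat_acoe.
exists rho_pihat, rho; split => // ec cec.
have := bound ec 0 cec (lexx 0); rewrite w_eq0 !mul0r.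
rewrite powR0 ?gt_eqF// !mulr0 !addr0; apply => xu.
by rewrite (le_trans (lossw xu))// w_eq0.
Qed.
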